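(* Let $\mathbb{E}(\kappa,\tau)$ be one of $\mathbb{S}^2(\kappa)\times\mathbb{R}$ ($\kappa>0,\tau=0$), $\mathrm{Nil}_3$ ($\kappa=0,\tau>0$), or $\widetilde{\mathrm{PSL}}_2(\mathbb{R})$ ($\kappa<0,\tau>0$), and suppose that the pitch $a$ is admissible. Let $\mathcal{T}_a=\{T_a(\mu):\mu\in(0,\infty)\}$ be a tube family of pitch $a$. Then there exist a neighborhood of $\mu=0$ and a neighborhood of $\mu=\infty$ such that $T_a(\mu)$ is embedded for all $\mu$ in these neighborhoods.
   Context: Ambient space. Let $\kappa\in\mathbb{R}$, $\tau\ge0$, $\kappa\ne4\tau^2$, $\varepsilon=\operatorname{sgn}(\kappa-4\tau^2)$. Let $\mathrm{sn}_\kappa(r)=\frac{1}{\sqrt\kappa}\sin(\sqrt\kappa r),\ r,\ \frac{1}{\sqrt{-\kappa}}\sinh(\sqrt{-\kappa}r)$ and $\mathrm{cs}_\kappa(r)=\cos(\sqrt\kappa r),\ 1,\ \cosh(\sqrt{-\kappa}r)$ for $\kappa>0$, $\kappa=0$, $\kappa<0$ respectively. $\mathbb{E}(\kappa,\tau)$ is the homogeneous 3-manifold fibering over the simply connected surface of curvature $\kappa$ with geodesic fibers and bundle curvature $\tau$. Coordinates (away from the fiber over $r=0$ and, if $\kappa>0$, the fiber over $r=\pi/\sqrt\kappa$): $r\in I_\kappa$, $\theta\in[0,2\pi)$ (modulo $2\pi$), $z\in\mathbb{R}$, with $I_\kappa=(0,\infty)$ if $\kappa\le0$ and $I_\kappa=(0,\pi/\sqrt\kappa)$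 if $\kappa>0$, and metric $dr^2+\mathrm{sn}_\kappa^2(r)d\theta^2+(4\tau\,\mathrm{sn}_\kappa^2(\frac r2)d\theta-dz)^2$. The screw motion group of pitch $a\in\mathbb{R}$ is $G_a=\{(r,\theta,z)\mapsto(r,\theta+s,z+as):s\in\mathbb{R}\}$; $(r,h)$ are coordinates on the orbit space. The pitch $a$ is admissible if $a\tau\varepsilon\in(-\infty,\frac\varepsilon2)$ when $\kappa\le0$, or $a\tau\varepsilon\in[\frac{2\tau^2\varepsilon}{\kappa},\frac\varepsilon2)$ when $\kappa>0$. Surfaces. Let $\Xi=\{(H,J):H>0,\ J\in(-\frac{4H}{\kappa},0)\}$ if $\kappa>0$ and $\Xi=\{(H,J):H>\frac{\sqrt{-\kappa}}2,\ J<0\}$ if $\kappa\le0$. For $(H,J)\in\Xi$ and $\sigma\in\mathbb{R}$ let $r(\sigma)\in I_\kappa$ be the unique solution of $\frac{2H}{\kappa}(\mathrm{cs}_\kappa(r)-1)+\mathrm{sn}_\kappa(r)\sin\sigma=J$ (for $\kappa=0$: $-Hr^2+r\sin\sigma=J$) and $$h_a(\sigma)=\int_{\pi/2}^\sigma\frac{dh}{d\sigma}\,d\sigma,\qquad \frac{dh}{d\sigma}=\frac{\sqrt{\mathrm{sn}_\kappa^2(r)+(4\tau\,\mathrm{sn}_\kappa^2(\frac r2)-a)^2}}{2H\,\mathrm{sn}_\kappa(r)-\mathrm{cs}_\kappa(r)\sin\sigma}\sin\sigma .$$ The profile curve is $\gamma_a(H,J)(\sigma)=(r(\sigma),h_a(\sigma))$;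 the surface $\Sigma_a(H,J)=\{(r(\sigma),s,h_a(\sigma)+as)\}$ is $G_a$-invariant with constant mean curvature $H$ (surfaces are considered up to vertical translation). Closing defect: $\delta_a(H,J)=\int_{\pi/2}^{3\pi/2}\frac{dh}{d\sigma}d\sigma$. $\Sigma_a(H,J)$ is a (screw motion) tube if its profile curve is a simple closed curve, equivalently $\delta_a(H,J)=0$. Tube region: $\Theta_a=\delta_a^{-1}(0)\subseteq\Xi$. Tube family. Let $\overline\Theta_a$ be the closure of $\Theta_a$ in the closure of $\Xi$ and $\partial\Theta_a=\overline\Theta_a\setminus\Theta_a$. For $a$ admissible, a tube family is $\mathcal{T}_a=\{T_a(\mu)=\Sigma_a(H(\mu),J(\mu)):\mu\in(0,\infty)\}$, where $\mu\mapsto(H(\mu),J(\mu))$, $[0,\infty)\to\overline\Theta_a$, is a continuous curve with $(H(\mu),J(\mu))\in\Theta_a$ for $\mu>0$, $(H(0),J(0))\in\partial\Theta_a$, and $(H(\mu),J(\mu))\to(\infty,-\infty)$ as $\mu\to\infty$ (such a curve exists, parameterizing a subset of $\Theta_a$; it need not be unique, and one such choice is fixed). If $2\tau^2-a\tau\kappa=0$, then $\Theta_a=\{(H,-\frac{2H}\kappa):H>0\}$ and one takes $H(\mu)=\mu$, $J(\mu)=-\frac{2\mu}\kappa$. *)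

(* Defs.v *)
From Stdlib Require Import Reals.
From Coquelicot Require Import Coquelicot.

Open Scope R_scope.

Definition sn (kappa r : R) : R :=
  if Rlt_dec 0 kappa then sin (sqrt kappa * r) / sqrt kappa
  else if Rlt_dec kappa 0 then sinh (sqrt (- kappa) * r) / sqrt (- kappa)
  else r.

Definition cs (kappa r : R) : R :=
  if Rlt_dec 0 kappa then cos (sqrt kappa * r)
  else if Rlt_dec kappa 0 then cosh (sqrt (- kappa) * r)
  else 1.

Definition I_dom (kappa r : R) : Prop :=
  0 < r /\ (0 < kappa -> r < PI / sqrt kappa).

Definition is_S2xR (kappa tau : R) : Prop := 0 < kappa /\ tau = 0.
Definition is_Nil3 (kappa tau : R) : Prop := kappa = 0 /\ 0 < tau.
Definition is_PSL2 (kappa tau : R) : Prop := kappa < 0 /\ 0 < tau.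

Definition admissible (kappa tau a : R) : Prop :=
  let eps := sign (kappa - 4 * tau ^ 2) in
  (kappa <= 0 -> a * tau * eps < eps / 2) /\
  (0 < kappa -> 2 * tau ^ 2 * eps / kappa <= a * tau * eps < eps / 2).

Definition Xi (kappa : R) (p : R * R) : Prop :=
  let (H, J) := p in
  (0 < kappa -> 0 < H /\ - (4 * H / kappa) < J < 0) /\
  (kappa <= 0 -> sqrt (- kappa) / 2 < H /\ J < 0).

Definition first_integral (kappa H r sigma : R) : R :=
  (if Req_dec_T kappa 0 then - H * r ^ 2
   else 2 * H / kappa * (cs kappa r - 1)) + sn kappa r * sin sigma.

(* For (H, J) in Xi the solution exists and is unique, so that iota picks it. *)
Definition radius (kappa H J sigma : R) : R :=
  iota (fun r : R => I_dom kappa r /\ first_integral kappa H r sigma = J).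

Definition dheight (kappa tau a H J sigma : R) : R :=
  let r := radius kappa H J sigma in
  sqrt (sn kappa r ^ 2 + (4 * tau * sn kappa (r / 2) ^ 2 - a) ^ 2)
  / (2 * H * sn kappa r - cs kappa r * sin sigma) * sin sigma.

Definition height (kappa tau a H J sigma : R) : R :=
  RInt (dheight kappa tau a H J) (PI / 2) sigma.

Definition closing_defect (kappa tau a H J : R) : R :=
  RInt (dheight kappa tau a H J) (PI / 2) (3 * PI / 2).

Definition Theta (kappa tau a : R) (p : R * R) : Prop :=
  Xi kappa p /\ closing_defect kappa tau a (fst p) (snd p) = 0.

Definition closure {T : UniformSpace} (A : T -> Prop) (p : T) : Prop :=
  forall P : T -> Prop, locally p P -> exists q : T, P q /\ A q.

Definition Theta_closure (kappa tau a : R) (p : R * R) : Prop :=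
  closure (Xi kappa) p /\ closure (Theta kappa tau a) p.

Definition Theta_boundary (kappa tau a : R) (p : R * R) : Prop :=
  Theta_closure kappa tau a p /\ ~ Theta kappa tau a p.

(* c mu = (H(mu), J(mu)); only the values for mu >= 0 matter. *)
Definition tube_family (kappa tau a : R) (c : R -> R * R) : Prop :=
  continuous_on (fun mu => 0 <= mu) c /\
  (forall mu, 0 <= mu -> Theta_closure kappa tau a (c mu)) /\
  (forall mu, 0 < mu -> Theta kappa tau a (c mu)) /\
  Theta_boundary kappa tau a (c 0) /\
  is_lim (fun mu => fst (c mu)) p_infty p_infty /\
  is_lim (fun mu => snd (c mu)) p_infty m_infty /\
  (2 * tau ^ 2 - a * tau * kappa = 0 ->
   forall mu, 0 <= mu -> c mu = (mu, - (2 * mu / kappa))).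

(* The coordinate domain of E(kappa, tau), which is open in E(kappa, tau), is
   realized as I_kappa x S^1 x R, where the angle theta modulo 2 pi is the point
   (cos theta, sin theta) of the unit circle.  All the tubes lie in it, and being
   embedded depends only on its differentiable structure, not on the metric. *)
Definition chart : Type := (R * (R * R) * R)%type.

Definition chart_point (r theta z : R) : chart := (r, (cos theta, sin theta), z).

(* The parameters s and t give the same element of the screw motion group G_a. *)
Definition same_screw_motion (a s t : R) : Prop :=
  forall r theta z : R,
    chart_point r (theta + s) (z + a * s) = chart_point r (theta + t) (z + a * t).

(* p = (sigma, s) parametrizes Sigma_a(H, J). *)
Definition screw_surface (kappa tau a H J : R) (p : R * R) : chart :=
  chart_point (radius kappa H J (fst p)) (snd p)
              (height kappa tau a H J (fst p) + a * snd p).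

(* Equality of parameters in (R / 2 pi Z) x G_a, the abstract surface underlying
   a tube: a cylinder for a <> 0 and a torus for a = 0. *)
Definition same_tube_point (a : R) (p q : R * R) : Prop :=
  (exists k : Z, fst q = fst p + 2 * PI * IZR k) /\
  same_screw_motion a (snd p) (snd q).

Definition C1_immersion {U V : NormedModule R_AbsRing} (X : U -> V) : Prop :=
  exists DX : U -> U -> V,
    (forall p, filterdiff X (locally p) (DX p)) /\
    (forall p v, continuous (fun q => DX q v) p) /\
    (forall p v, DX p v = zero -> v = zero).

(* X induces an embedding of the quotient of U by the relation E (the orbit
   relation of a properly discontinuous group of translations): it is an
   immersion, it descends to an injective map on the quotient, and this map is
   open onto its image, i.e. its inverse is continuous. *)
Definition induces_embedding {U V : NormedModule R_AbsRing}
    (E : U -> U -> Prop) (X : U -> V) : Prop :=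
  C1_immersion X /\
  (forall p q, X p = X q <-> E p q) /\
  (forall p (P : U -> Prop), locally p P ->
     locally (X p) (fun y => forall q, X q = y -> exists q', E q q' /\ P q')).

Definition embedded_tube (kappa tau a : R) (p : R * R) : Prop :=
  induces_embedding (same_tube_point a)
    (screw_surface kappa tau a (fst p) (snd p)).

(* Main.v *)
(** In the coordinate t = tan(r/2) (its analogue for the curvature kappa) the first
    integral is a quadratic equation whose larger root t(s), s = sin sigma, gives
    the profile, and dh/dsigma = W(t(s)) s / D(s), where W is the length of the
    Killing field and D the square root of the discriminant.  The profile is
    symmetric under sigma |-> PI - sigma, and it meets the vertical lines in pairs
    of points.  Hence a closed profile is simple, and the tube is embedded as soon
    as the profile is lower than the distance 2 PI |a| of consecutive points of an
    orbit on a vertical line.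

    If kappa <= 0, every tube is embedded: with x = sn(r/2)^2, W^2 is a convex
    quadratic in x, t(s) t(-s) does not depend on s, and x is a convex function of
    ln t.  So if the value of x at s = 0 were beyond the minimum of W^2, then
    W(t(s)) > W(t(-s)) for all s > 0 and the profile would not close.  Otherwise
    W(t(s)) <= a for s <= 0, and the height is at most PI a.

    If kappa > 0 and tau = 0, then W^2 = a^2 + (2 mu / (kappa D))^2 explicitly, and
    the height is at most PI |a| + o(1) both as mu tends to 0 and to infinity. *)

Require Import Defs.
From Stdlib Require Import Reals ZArith Lra Lia Classical ClassicalEpsilon.
From Coquelicot Require Import Coquelicot.

(** * Embeddings of screw motion surfaces *)

Lemma continuous_pair {U V W : UniformSpace} (f : U -> V) (g : U -> W) (x : U) :
  continuous f x -> continuous g x -> continuous (fun y => (f y, g y)) x.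
Proof.
intros Hf Hg. apply filterlim_locally. intros eps.
generalize (proj1 (filterlim_locally _ _) Hf eps) (proj1 (filterlim_locally _ _) Hg eps).
intros H1 H2. generalize (filter_and _ _ H1 H2). apply filter_imp.
intros y [A B]. split; assumption.
Qed.

Lemma is_linear_inl {K : AbsRing} {V W : NormedModule K} :
  is_linear (fun v : V => (v, zero : W)).
Proof.
split.
- intros u v. change ((plus u v, zero : W) = (plus u v, plus zero zero : W)).
  now rewrite plus_zero_r.
- intros k u. exact (f_equal (pair (scal k u)) (eq_sym (scal_zero_r (V := W) k))).
- exists (sqrt 2). split; [apply Rlt_sqrt2_0|]. intros u.
  eapply Rle_trans; [apply norm_prod|].
  rewrite norm_zero, Rmax_left; [apply Rle_refl | apply norm_ge_0].
Qed.

Lemma is_linear_inr {K : AbsRing} {V W : NormedModule K} :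
  is_linear (fun w : W => (zero : V, w)).
Proof.
split.
- intros u v. change ((zero : V, plus u v) = (plus zero zero : V, plus u v)).
  now rewrite plus_zero_r.
- intros k u.
  exact (f_equal (fun v => (v, scal k u)) (eq_sym (scal_zero_r (V := V) k))).
- exists (sqrt 2). split; [apply Rlt_sqrt2_0|]. intros u.
  eapply Rle_trans; [apply norm_prod|].
  rewrite norm_zero, Rmax_right; [apply Rle_refl | apply norm_ge_0].
Qed.

(** The pair is the sum of [(f, 0)] and [(0, g)], so the chain rule for the two linear inclusions
    and the sum rule apply. *)
Lemma filterdiff_pair {K : AbsRing} {U V W : NormedModule K}
    (f lf : U -> V) (g lg : U -> W) (x : U) :
  filterdiff f (locally x) lf -> filterdiff g (locally x) lg ->
  filterdiff (fun y => (f y, g y)) (locally x) (fun y => (lf y, lg y)).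
Proof.
intros Hf Hg.
assert (Hs : forall v w, plus (v, zero : W) (zero : V, w) = (v, w)).
{ intros v w. change ((plus v zero, plus zero w) = (v, w)).
  now rewrite plus_zero_l, plus_zero_r. }
apply filterdiff_ext with (fun y => plus (f y, zero : W) (zero : V, g y)).
{ intros y. apply Hs. }
apply filterdiff_ext_lin with (fun y => plus (lf y, zero : W) (zero : V, lg y)).
2: { intros y. apply Hs. }
apply (filterdiff_plus_fct (V := prod_NormedModule K V W)
  (fun y => (f y, zero : W)) (fun y => (zero : V, g y))
  (fun y => (lf y, zero : W)) (fun y => (zero : V, lg y))).
- apply (filterdiff_comp' (W := prod_NormedModule K V W)
    f (fun v => (v, zero : W)) x lf (fun v => (v, zero : W))); [assumption|].
  apply filterdiff_linear, is_linear_inl.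
- apply (filterdiff_comp' (W := prod_NormedModule K V W)
    g (fun w => (zero : V, w)) x lg (fun w => (zero : V, w))); [assumption|].
  apply filterdiff_linear, is_linear_inr.
Qed.

Lemma filterdiff_fst (f : R -> R) (l : R) (p : R * R) :
  is_derive f (fst p) l ->
  filterdiff (fun q : R * R => f (fst q)) (locally p) (fun v : R * R => fst v * l).
Proof.
intros Hf. apply (filterdiff_comp' (fun q : R * R => fst q) f p
  (fun q => fst q) (fun y => y * l)).
- apply filterdiff_linear, is_linear_fst.
- exact Hf.
Qed.

Lemma filterdiff_snd (f : R -> R) (l : R) (p : R * R) :
  is_derive f (snd p) l ->
  filterdiff (fun q : R * R => f (snd q)) (locally p) (fun v : R * R => snd v * l).
Proof.
intros Hf. apply (filterdiff_comp' (fun q : R * R => snd q) f p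
  (fun q => snd q) (fun y => y * l)).
- apply filterdiff_linear, is_linear_snd.
- exact Hf.
Qed.

(* By compactness of the rectangle, X q stays away from X p unless q lies in one
   of the finitely many rectangles around the points equivalent to p. *)
Lemma locally_inverse {V : NormedModule R_AbsRing} (E : R * R -> R * R -> Prop)
    (X : R * R -> V) (p : R * R) (a b a' b' : R) (P : R * R -> Prop) :
  (forall q, continuous X q) ->
  (forall q, X q = X p -> locally q (fun x => exists y, E x y /\ P y)) ->
  (forall x y z, E x y -> E y z -> E x z) ->
  locally (X p) (fun y => forall q, X q = y ->
    exists q1, E q q1 /\ X q1 = y /\ a <= fst q1 <= b /\ a' <= snd q1 <= b') ->
  locally (X p) (fun y => forall q, X q = y -> exists q', E q q' /\ P q').
Proof.
intros HX HE Htrans Hrect.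
(* Each point gets its own radius: near a point of the fiber over [X p] everything is equivalent to
   a point of [P], near any other point [X] stays off a ball around [X p]. *)
assert (Hd : forall u v, exists d : posreal, forall x y,
  Rabs (x - u) < d -> Rabs (y - v) < d ->
  ~ ball (X p) d (X (x, y)) \/ exists q', E (x, y) q' /\ P q').
{ intros u v. destruct (classic (X (u, v) = X p)) as [He | Hne].
  - destruct (HE _ He) as [d Hd]. exists d. intros x y Hx Hy. right.
    apply Hd. split; assumption.
  - assert (Hc : exists e : posreal, ~ ball (X p) e (X (u, v))).
    { apply not_all_ex_not. intros Hc. apply Hne. symmetry. apply eq_close.
      exact Hc. }
    destruct Hc as [e He].
    destruct (proj1 (filterlim_locally _ _) (HX (u, v)) (pos_div_2 e)) as [d Hd].
    assert (Hm : 0 < Rmin d (e / 2)).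
    { apply Rmin_pos; [apply cond_pos | apply (cond_pos (pos_div_2 e))]. }
    exists (mkposreal _ Hm). simpl. intros x y Hx Hy. left. intros Hb. apply He.
    replace (pos e) with (e / 2 + e / 2) by field.
    apply ball_triangle with (X (x, y)).
    + eapply ball_le; [apply Rmin_r | exact Hb].
    + apply ball_sym, Hd. split.
      * eapply Rlt_le_trans; [exact Hx | apply Rmin_l].
      * eapply Rlt_le_trans; [exact Hy | apply Rmin_l]. }
set (delta := fun u v => proj1_sig (constructive_indefinite_description _ (Hd u v))).
(* A single [d] lies below the gauge of some center close to any given point of the rectangle; this
   center exists only up to double negation, whence [NNPP] below. *)
destruct (compactness_value_2d a b a' b' delta) as [d Hcomp].
assert (Hball : locally (X p) (ball (X p) d)) by (exists d; tauto).
generalize (filter_and _ _ Hrect Hball). apply filter_imp. intros z [Hz Hzd] q Hq.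
destruct (Hz q Hq) as [[x y] [HE1 [HX1 [Hx Hy]]]]. simpl in Hx, Hy.
apply NNPP. intros Hno. apply (Hcomp x y Hx Hy). intros [u [v [_ [_ [Hu [Hv Hle]]]]]].
destruct (proj2_sig (constructive_indefinite_description _ (Hd u v)) x y Hu Hv)
  as [Hfar | [q' [Hq' HP]]].
- apply Hfar. rewrite HX1. eapply ball_le; [exact Hle | exact Hzd].
- apply Hno. exists q'. split; [eapply Htrans; eassumption | exact HP].
Qed.

Notation plane := (prod_NormedModule R_AbsRing R_NormedModule R_NormedModule).
Notation chart_space :=
  (prod_NormedModule R_AbsRing
     (prod_NormedModule R_AbsRing R_NormedModule plane) R_NormedModule).

(** * Angles modulo 2 PI and the parameter space of a tube *)

Lemma sin_2PI_IZR (k : Z) : sin (2 * PI * IZR k) = 0.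
Proof. apply sin_eq_0_1. exists (2 * k)%Z. rewrite mult_IZR. ring. Qed.

Lemma cos_2PI_IZR (k : Z) : cos (2 * PI * IZR k) = 1.
Proof.
replace (2 * PI * IZR k) with (2 * (IZR k * PI)) by ring.
rewrite cos_2a_sin, (sin_eq_0_1 (IZR k * PI)) by (exists k; reflexivity). ring.
Qed.

Lemma sin_period_IZR (x : R) (k : Z) : sin (x + 2 * PI * IZR k) = sin x.
Proof. rewrite sin_plus, sin_2PI_IZR, cos_2PI_IZR. ring. Qed.

Lemma cos_period_IZR (x : R) (k : Z) : cos (x + 2 * PI * IZR k) = cos x.
Proof. rewrite cos_plus, sin_2PI_IZR, cos_2PI_IZR. ring. Qed.

Lemma period_IZR {T : Type} (f : R -> T) :
  (forall x, f (x + 2 * PI) = f x) -> forall x (k : Z), f (x + 2 * PI * IZR k) = f x.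
Proof.
intros Hf.
assert (Hn : forall (n : nat) x, f (x + 2 * PI * INR n) = f x).
{ induction n as [|n IH]; intros x.
  - f_equal. simpl. ring.
  - rewrite S_INR. replace (x + 2 * PI * (INR n + 1)) with (x + 2 * PI * INR n + 2 * PI) by ring.
    now rewrite Hf. }
intros x k. destruct (Z_le_dec 0 k) as [Hk | Hk].
- rewrite <- (Z2Nat.id k Hk), <- INR_IZR_INZ. apply Hn.
- rewrite <- (Hn (Z.to_nat (- k)) (x + 2 * PI * IZR k)). f_equal.
  rewrite INR_IZR_INZ, Z2Nat.id by lia. rewrite opp_IZR. ring.
Qed.

Lemma circle_eq (s t : R) :
  cos s = cos t -> sin s = sin t -> exists k : Z, t = s + 2 * PI * IZR k.
Proof.
intros Hc Hs.
assert (H1 : cos (t - s) = 1).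
{ rewrite cos_minus, Hc, Hs. generalize (sin2_cos2 t). unfold Rsqr. lra. }
replace (t - s) with (2 * ((t - s) / 2)) in H1 by field.
rewrite cos_2a_sin in H1.
assert (H2 : sin ((t - s) / 2) = 0) by nra.
destruct (sin_eq_0_0 _ H2) as [k Hk]. exists k. lra.
Qed.

Lemma sin_eq (s t : R) :
  sin s = sin t ->
  (exists k : Z, t = s + 2 * PI * IZR k) \/ (exists k : Z, t = PI - s + 2 * PI * IZR k).
Proof.
intros Hs. destruct (Req_dec (cos s) (cos t)) as [Hc | Hc].
- left. now apply circle_eq.
- right. apply circle_eq.
  + rewrite Rtrigo_facts.cos_pi_minus.
    generalize (sin2_cos2 s) (sin2_cos2 t). unfold Rsqr. rewrite Hs. intros H1 H2.
    assert (H3 : (cos s - cos t) * (cos s + cos t) = 0) by lra.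
    apply Rmult_integral in H3. lra.
  + now rewrite sin_PI_x.
Qed.

Lemma shift_2PI (c x : R) : exists k : Z, c <= x + 2 * PI * IZR k <= c + 2 * PI.
Proof.
assert (HPI := PI_RGT_0).
destruct (base_Int_part ((x - c) / (2 * PI))) as [H1 H2].
exists (- Int_part ((x - c) / (2 * PI)))%Z. rewrite opp_IZR.
set (u := (x - c) / (2 * PI)) in *.
assert (Hu : x - c = 2 * PI * u) by (unfold u; field; lra).
nra.
Qed.

(** A screw motion is determined by its value at one point of the chart, which yields the angle
    modulo 2 PI and the translation. So the second parameter runs over a circle for [a = 0] and over
    a line otherwise. *)
Lemma same_tube_pointE (a : R) (p q : R * R) :
  same_tube_point a p q <->
  (exists k : Z, fst q = fst p + 2 * PI * IZR k) /\
  (exists k : Z, snd q = snd p + 2 * PI * IZR k) /\ a * snd p = a * snd q.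
Proof.
unfold same_tube_point, same_screw_motion. split; intros [Hk H]; split; try exact Hk.
- generalize (H 0 0 0). unfold chart_point. intros He. injection He as H1 H2 H3.
  rewrite !Rplus_0_l in H1, H2, H3.
  split; [now apply circle_eq | assumption].
- destruct H as [[k H1] H2]. intros r theta z. unfold chart_point. rewrite <- H2, H1.
  replace (theta + (snd p + 2 * PI * IZR k)) with (theta + snd p + 2 * PI * IZR k) by ring.
  now rewrite sin_period_IZR, cos_period_IZR.
Qed.

Lemma same_tube_point_trans (a : R) (p q u : R * R) :
  same_tube_point a p q -> same_tube_point a q u -> same_tube_point a p u.
Proof.
rewrite !same_tube_pointE. intros [[k Hk] [[l Hl] Ha]] [[k' Hk'] [[l' Hl'] Ha']].
repeat split.
- exists (k + k')%Z. rewrite plus_IZR. lra.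
- exists (l + l')%Z. rewrite plus_IZR. lra.
- lra.
Qed.

(** The translation carrying [q] to [p] moves every point within its equivalence class. *)
Lemma same_tube_point_locally (a : R) (p q : R * R) (P : R * R -> Prop) :
  same_tube_point a q p -> locally p P ->
  locally q (fun x => exists y, same_tube_point a x y /\ P y).
Proof.
intros Hqp [d Hd]. exists d. intros x Hx.
exists (fst x + (fst p - fst q), snd x + (snd p - snd q)). split.
- apply same_tube_pointE in Hqp. destruct Hqp as [[k Hk] [[l Hl] Ha]].
  apply same_tube_pointE. simpl. repeat split.
  + exists k. lra.
  + exists l. lra.
  + lra.
- apply Hd. destruct Hx as [H1 H2].
  split; unfold ball in *; simpl in *; unfold AbsRing_ball, abs, minus, plus, opp in *; simpl in *.
  + replace (fst x + (fst p - fst q) + - fst p) with (fst x + - fst q) by ring. exact H1.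
  + replace (snd x + (snd p - snd q) + - snd p) with (snd x + - snd q) by ring. exact H2.
Qed.

(** * Embedding criterion for a screw motion surface with a general periodic profile *)

Definition screw_map (a : R) (r h : R -> R) (p : R * R) : chart :=
  chart_point (r (fst p)) (snd p) (h (fst p) + a * snd p).

Section ScrewMap.

Variables (a : R) (r h dr dh : R -> R).
Hypothesis (r_deriv : forall x, is_derive r x (dr x)).
Hypothesis (h_deriv : forall x, is_derive h x (dh x)).
Hypothesis (dr_cont : forall x, continuous dr x).
Hypothesis (dh_cont : forall x, continuous dh x).
Hypothesis (regular : forall x, dr x = 0 -> dh x <> 0).

(** On a kernel vector of the differential, the circle factor forces the second component to vanish;
    the first one then vanishes by [regular]. *)
Lemma screw_map_C1_immersion :
  @C1_immersion plane chart_space (screw_map a r h).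
Proof.
exists (fun p v => ((fst v * dr (fst p), (snd v * - sin (snd p), snd v * cos (snd p))),
  fst v * dh (fst p) + snd v * a)).
split; [|split].
- intros p. unfold screw_map, chart_point.
  apply (filterdiff_pair (V := prod_NormedModule R_AbsRing R_NormedModule plane) (W := R_NormedModule)
    (fun q : R * R => (r (fst q), (cos (snd q), sin (snd q))))
    (fun v => (fst v * dr (fst p), (snd v * - sin (snd p), snd v * cos (snd p))))
    (fun q : R * R => h (fst q) + a * snd q)
    (fun v => fst v * dh (fst p) + snd v * a)).
  + apply (filterdiff_pair (V := R_NormedModule)
       (W := plane)
      (fun q : R * R => r (fst q)) (fun v => fst v * dr (fst p))
      (fun q : R * R => (cos (snd q), sin (snd q)))
      (fun v => (snd v * - sin (snd p), snd v * cos (snd p)))).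
    * now apply filterdiff_fst.
    * apply (filterdiff_pair (V := R_NormedModule) (W := R_NormedModule)
        (fun q : R * R => cos (snd q)) (fun v => snd v * - sin (snd p))
        (fun q : R * R => sin (snd q)) (fun v => snd v * cos (snd p))).
      -- apply filterdiff_snd, is_derive_Reals, derivable_pt_lim_cos.
      -- apply filterdiff_snd, is_derive_Reals, derivable_pt_lim_sin.
  + apply (filterdiff_plus_fct (V := R_NormedModule)
      (fun q : R * R => h (fst q)) (fun q : R * R => a * snd q)
      (fun v : R * R => fst v * dh (fst p)) (fun v : R * R => snd v * a)).
    * now apply filterdiff_fst.
    * apply (filterdiff_snd (fun s => a * s)). auto_derive; [exact I | ring].
- intros p v.
  assert (C1 : forall (f : R -> R) c, continuous f (fst p) ->
    continuous (fun q : R * R => c * f (fst q)) p).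
  { intros f c Hf. apply (continuous_scal_r c (fun q : R * R => f (fst q))).
    apply (continuous_comp (fun q : R * R => fst q) f); [destruct p; apply continuous_fst | exact Hf]. }
  assert (C2 : forall (f : R -> R) c, continuous f (snd p) ->
    continuous (fun q : R * R => c * f (snd q)) p).
  { intros f c Hf. apply (continuous_scal_r c (fun q : R * R => f (snd q))).
    apply (continuous_comp (fun q : R * R => snd q) f); [destruct p; apply continuous_snd | exact Hf]. }
  apply (continuous_pair (fun q : R * R =>
    (fst v * dr (fst q), (snd v * - sin (snd q), snd v * cos (snd q))))
    (fun q : R * R => fst v * dh (fst q) + snd v * a)).
  + apply (continuous_pair (fun q : R * R => fst v * dr (fst q))
      (fun q : R * R => (snd v * - sin (snd q), snd v * cos (snd q)))).
    * now apply C1.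
    * apply (continuous_pair (fun q : R * R => snd v * - sin (snd q))
      (fun q : R * R => snd v * cos (snd q))).
      -- apply (C2 (fun s => - sin s)). apply (continuous_opp (V := R_NormedModule) sin).
         apply continuous_sin.
      -- apply C2. apply continuous_cos.
  + apply (continuous_plus (V := R_NormedModule)
      (fun q : R * R => fst v * dh (fst q)) (fun q => snd v * a)).
    * now apply C1.
    * apply continuous_const.
- intros p [v1 v2] Hv. simpl in Hv.
  injection Hv as H1 H2 H3 H4.
  change (v1 * dr (fst p) = 0) in H1. change (v2 * - sin (snd p) = 0) in H2.
  change (v2 * cos (snd p) = 0) in H3. change (v1 * dh (fst p) + v2 * a = 0) in H4.
  assert (Hv2 : @eq R v2 0).
  { generalize (sin2_cos2 (snd p)). unfold Rsqr. intros Hsc.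
    replace v2 with ((v2 * - sin (snd p)) * - sin (snd p) + (v2 * cos (snd p)) * cos (snd p)).
    - rewrite H2, H3. ring.
    - transitivity (v2 * (sin (snd p) * sin (snd p) + cos (snd p) * cos (snd p))); [ring|].
      rewrite Hsc. ring. }
  subst v2.
  assert (Hv1 : @eq R v1 0).
  { rewrite Rmult_0_l, Rplus_0_r in H4.
    apply Rmult_integral in H1. destruct H1 as [H1 | H1]; [exact H1|].
    apply Rmult_integral in H4. destruct H4 as [H4 | H4]; [exact H4|].
    now elim (regular _ H1). }
  now rewrite Hv1.
Qed.

Hypothesis (r_period : forall x, r (x + 2 * PI) = r x).
Hypothesis (h_period : forall x, h (x + 2 * PI) = h x).
Hypothesis (r_inj : forall x y, r x = r y -> sin x = sin y).
Hypothesis (r_sym : forall x, r (PI - x) = r x).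
Hypothesis (h_sym : forall x, h (PI - x) = - h x).
Hypothesis (h_neg : forall x, - (PI / 2) < x < PI / 2 -> h x < 0).
Hypothesis (h_lower : a <> 0 -> forall x, - (PI / 2) < x < PI / 2 -> - h x < PI * Rabs a).

Lemma h_PI2 : h (PI / 2) = 0.
Proof.
generalize (h_sym (PI / 2)). replace (PI - PI / 2) with (PI / 2) by field. lra.
Qed.

Lemma h_opp_PI2 : h (- (PI / 2)) = 0.
Proof.
generalize (h_sym (- (PI / 2))) (h_period (- (PI / 2))).
replace (PI - - (PI / 2)) with (- (PI / 2) + 2 * PI) by field. lra.
Qed.

(** Periodicity and the reflection x |-> PI - x carry every parameter into [-PI/2, PI/2]. *)
Lemma h_bound (x : R) : a <> 0 -> Rabs (h x) <= PI * Rabs a.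
Proof.
intros Ha. assert (HPI := PI_RGT_0).
assert (Hpos : 0 < PI * Rabs a) by (apply Rmult_lt_0_compat; [assumption | now apply Rabs_pos_lt]).
assert (Hb : forall y, - (PI / 2) <= y <= PI / 2 -> Rabs (h y) <= PI * Rabs a).
{ intros y Hy.
  destruct (Req_dec y (PI / 2)) as [->|H1]; [rewrite h_PI2, Rabs_R0; lra|].
  destruct (Req_dec y (- (PI / 2))) as [->|H2]; [rewrite h_opp_PI2, Rabs_R0; lra|].
  rewrite Rabs_left; [|apply h_neg; lra]. apply Rlt_le, h_lower; [exact Ha | lra]. }
destruct (shift_2PI (- (PI / 2)) x) as [k Hk].
rewrite <- (period_IZR h h_period x k).
destruct (Rle_dec (x + 2 * PI * IZR k) (PI / 2)) as [H1|H1].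
- apply Hb; lra.
- rewrite <- Rabs_Ropp, <- h_sym. apply Hb; lra.
Qed.

(* Two points of the profile on the same orbit are exchanged by the reflection
   x |-> PI - x, and their heights differ by twice the height of one of them,
   which is less than the distance 2 PI |a| of consecutive points of an orbit on
   a vertical line. *)
Lemma screw_map_inj (p q : R * R) :
  screw_map a r h p = screw_map a r h q <-> same_tube_point a p q.
Proof.
assert (HPI := PI_RGT_0).
rewrite same_tube_pointE. unfold screw_map, chart_point. destruct p as [x s], q as [y t]; simpl.
split.
- intros Heq. injection Heq as Hr Hcos Hsin Hz.
  destruct (circle_eq _ _ Hcos Hsin) as [l Hl].
  assert (Hsame : (exists k, y = x + 2 * PI * IZR k) ->
    (exists k, y = x + 2 * PI * IZR k) /\ (exists k, t = s + 2 * PI * IZR k) /\ a * s = a * t).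
  { intros [k Hk]. repeat split; [now exists k | now exists l |].
    rewrite Hk, (period_IZR h h_period) in Hz. lra. }
  destruct (sin_eq x y (r_inj _ _ Hr)) as [Hk | [k Hk]]; [auto|].
  apply Hsame.
  assert (Hhy : h y = - h x) by (rewrite Hk, (period_IZR h h_period); apply h_sym).
  assert (Hal : - (2 * h x) = - (2 * PI * a * IZR l)) by (rewrite Hl in Hz; lra).
  destruct (Req_dec (h x) 0) as [H0 | H0].
  + (* only the points PI/2 and -PI/2, which the reflection fixes, have height 0 *)
    destruct (shift_2PI (- (PI / 2)) x) as [m Hm].
    rewrite <- (period_IZR h h_period x m) in H0.
    set (u := x + 2 * PI * IZR m) in *.
    assert (Hu : u = - (PI / 2) \/ u = PI / 2 \/ u = 3 * (PI / 2)).
    { destruct (Rlt_dec u (PI / 2)) as [H1|H1].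
      - left. destruct (Req_dec u (- (PI / 2))) as [|H2]; [assumption|].
        assert (h u < 0) by (apply h_neg; lra). lra.
      - right. destruct (Req_dec u (PI / 2)) as [|H2]; [now left|].
        destruct (Req_dec u (3 * (PI / 2))) as [|H3]; [now right|].
        assert (h (PI - u) < 0) by (apply h_neg; lra). rewrite h_sym in H. lra. }
    unfold u in Hu. destruct Hu as [Hu | [Hu | Hu]].
    (* Here y - x = 2 PI k + (PI - 2 x), and PI - 2 x is 2 PI times 2 m + 1, 2 m or 2 m - 1 in the
       three cases. *)
    * exists (k + 2 * m + 1)%Z. rewrite !plus_IZR, mult_IZR. lra.
    * exists (k + 2 * m)%Z. rewrite !plus_IZR, mult_IZR. lra.
    * exists (k + 2 * m - 1)%Z. rewrite minus_IZR, !plus_IZR, mult_IZR. lra.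
  + exfalso. assert (Ha : a <> 0).
    { intros Ha. apply H0. rewrite Ha in Hal. lra. }
    assert (Hstrict : Rabs (h x) < PI * Rabs a).
    { destruct (shift_2PI (- (PI / 2)) x) as [m Hm].
      rewrite <- (period_IZR h h_period x m) in H0 |- *.
      set (u := x + 2 * PI * IZR m) in *.
      assert (u <> PI / 2) by (intros E; apply H0; rewrite E; apply h_PI2).
      assert (u <> - (PI / 2)) by (intros E; apply H0; rewrite E; apply h_opp_PI2).
      assert (u <> 3 * (PI / 2)).
      { intros E. apply H0. rewrite E. generalize (h_sym (- (PI / 2))).
        replace (PI - - (PI / 2)) with (3 * (PI / 2)) by field. rewrite h_opp_PI2. lra. }
      destruct (Rle_dec u (PI / 2)) as [H4|H4].
      - rewrite Rabs_left; [|apply h_neg; lra]. apply h_lower; [exact Ha | lra].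
      - rewrite <- Rabs_Ropp, <- h_sym.
        rewrite Rabs_left; [|apply h_neg; lra]. apply h_lower; [exact Ha | lra]. }
    assert (Hl0 : l <> 0%Z) by (intros E; apply H0; rewrite E in Hal; lra).
    assert (Hl1 : 1 <= Rabs (IZR l)).
    { rewrite <- abs_IZR. apply IZR_le. lia. }
    assert (HhE : h x = PI * (a * IZR l)) by lra.
    rewrite HhE, !Rabs_mult, (Rabs_pos_eq PI) in Hstrict by lra.
    assert (Hap := Rabs_pos a).
    apply Rmult_lt_reg_l in Hstrict; [|exact HPI]. nra.
- intros [[k Hk] [[l Hl] Ha]]. rewrite Hk, (period_IZR h h_period), (period_IZR r r_period), Ha.
  now rewrite <- (cos_period_IZR s l), <- (sin_period_IZR s l), <- Hl.
Qed.

(** Supplies the rectangle required by [locally_inverse]. For [a = 0] both parameters are reduced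
    modulo 2 PI; for [a <> 0] only the first is, and the second is controlled by the
    z-coordinate. *)
Lemma screw_map_bounded (p : R * R) :
  exists b1 b2 : R,
  @locally
  chart_space (screw_map a r h p) (fun y => forall q, screw_map a r h q = y ->
    exists q1, same_tube_point a q q1 /\ screw_map a r h q1 = y /\
      0 <= fst q1 <= 2 * PI /\ b1 <= snd q1 <= b2).
Proof.
destruct (Req_dec a 0) as [Ha | Ha].
- exists 0, (2 * PI). apply filter_forall. intros y q Hq.
  destruct (shift_2PI 0 (fst q)) as [k Hk]. destruct (shift_2PI 0 (snd q)) as [l Hl].
  exists (fst q + 2 * PI * IZR k, snd q + 2 * PI * IZR l).
  assert (HE : same_tube_point a q (fst q + 2 * PI * IZR k, snd q + 2 * PI * IZR l)).
  { apply same_tube_pointE. simpl. repeat split; [now exists k | now exists l |].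
    rewrite Ha. ring. }
  split; [exact HE|]. split; [|simpl; lra].
  rewrite <- Hq. symmetry. now apply screw_map_inj.
(* In the unit ball around the image of [p] the last coordinate h + a s is within 1 of [z], and |h|
   <= PI |a|, so |a s| <= |z| + 1 + PI |a|. *)
- set (z := h (fst p) + a * snd p). set (B := (Rabs z + 1 + PI * Rabs a) / Rabs a).
  exists (- B), B. exists (mkposreal 1 Rlt_0_1). intros y Hy q Hq.
  destruct (shift_2PI 0 (fst q)) as [k Hk].
  exists (fst q + 2 * PI * IZR k, snd q).
  assert (HE : same_tube_point a q (fst q + 2 * PI * IZR k, snd q)).
  { apply same_tube_pointE. simpl. repeat split; [now exists k |]. exists 0%Z. ring. }
  split; [exact HE|]. split; [rewrite <- Hq; symmetry; now apply screw_map_inj|].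
  split; [simpl; lra|]. simpl.
  rewrite <- Hq in Hy. destruct Hy as [_ Hy]. simpl in Hy.
  unfold ball in Hy; simpl in Hy; unfold AbsRing_ball, abs, minus, plus, opp in Hy; simpl in Hy.
  fold z in Hy.
  assert (HB : Rabs (snd q) <= B).
  { unfold B. assert (0 < Rabs a) by now apply Rabs_pos_lt.
    apply Rmult_le_reg_r with (Rabs a); [assumption|].
    unfold Rdiv. rewrite Rmult_assoc, Rinv_l, Rmult_1_r by lra.
    rewrite <- Rabs_mult.
    replace (snd q * a) with (z + (h (fst q) + a * snd q + - z) + - h (fst q)) by ring.
    eapply Rle_trans; [apply Rabs_triang|]. rewrite Rabs_Ropp.
    apply Rplus_le_compat; [|now apply h_bound].
    eapply Rle_trans; [apply Rabs_triang|]. lra. }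
  apply Rabs_le_between in HB. lra.
Qed.

Lemma screw_map_embedding :
  @induces_embedding plane chart_space (same_tube_point a) (screw_map a r h).
Proof.
split; [|split].
- apply screw_map_C1_immersion.
- apply screw_map_inj.
- intros p P HP. destruct (screw_map_bounded p) as [b1 [b2 Hb]].
  refine (locally_inverse (V := chart_space) (same_tube_point a) (screw_map a r h)
    p 0 (2 * PI) b1 b2 P _ _ _ Hb).
  + intros q. destruct screw_map_C1_immersion as [DX [HD _]].
    apply (filterdiff_continuous (U := plane) (V := chart_space)). exists (DX q). apply HD.
  + intros q Hq. apply same_tube_point_locally with p; [now apply screw_map_inj | exact HP].
  + apply same_tube_point_trans.
Qed.

End ScrewMap.

(** * The profile curve *)

(* [atn kappa] is the inverse of r |-> sn(r/2) / cs(r/2). *)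
Definition atn (kappa t : R) : R :=
  if Rlt_dec 0 kappa then 2 * atan (sqrt kappa * t) / sqrt kappa
  else if Rlt_dec kappa 0 then
    ln ((1 + sqrt (- kappa) * t) / (1 - sqrt (- kappa) * t)) / sqrt (- kappa)
  else 2 * t.

Lemma one_sub_pos (k t : R) : 0 < k -> 0 < t -> 0 < 1 - (k * t) ^ 2 -> 0 < 1 - k * t.
Proof. intros Hk Ht H. assert (0 < k * t) by nra. nra. Qed.

(** * Half-angle formulas *)

Section Atn.

Variables kappa t : R.
Hypothesis t_pos : 0 < t.
Hypothesis t_lt : 0 < 1 + kappa * t ^ 2.

Lemma sqrt_opp_one_sub : kappa < 0 -> 0 < 1 - sqrt (- kappa) * t.
Proof.
intros Hk. apply one_sub_pos; [apply sqrt_lt_R0; lra | exact t_pos |].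
rewrite Rpow_mult_distr, pow2_sqrt; lra.
Qed.

(** Double-angle formula for [kappa > 0]; for [kappa < 0], with u = sqrt(-kappa), it rests on e^(u
    r) = (1 + u t) / (1 - u t). *)
Lemma sn_atn : sn kappa (atn kappa t) = 2 * t / (1 + kappa * t ^ 2).
Proof.
unfold sn, atn. destruct (Rlt_dec 0 kappa) as [H1|H1]; [|destruct (Rlt_dec kappa 0) as [H2|H2]].
- assert (Hk := sqrt_lt_R0 _ H1).
  replace (sqrt kappa * (2 * atan (sqrt kappa * t) / sqrt kappa))
    with (2 * atan (sqrt kappa * t)) by (field; lra).
  rewrite sin_2a, sin_atan, cos_atan. set (u := sqrt kappa) in *.
  replace kappa with (u ^ 2) by (apply pow2_sqrt; lra).
  assert (Hp : 0 < 1 + (u * t)²) by (generalize (Rle_0_sqr (u * t)); lra).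
  transitivity (2 * t / (sqrt (1 + (u * t)²) * sqrt (1 + (u * t)²))).
  + field. generalize (sqrt_lt_R0 _ Hp). lra.
  + rewrite sqrt_sqrt by lra. f_equal. f_equal. unfold Rsqr. ring.
- assert (Hk : 0 < sqrt (- kappa)) by (apply sqrt_lt_R0; lra).
  assert (Hs := sqrt_opp_one_sub H2).
  assert (HE : (sqrt (- kappa)) ^ 2 = - kappa) by (apply pow2_sqrt; lra).
  set (u := sqrt (- kappa)) in *.
  replace kappa with (- u ^ 2) by lra.
  assert (Hq : 0 < (1 + u * t) / (1 - u * t)) by (apply Rdiv_lt_0_compat; nra).
  replace (u * (ln ((1 + u * t) / (1 - u * t)) / u))
    with (ln ((1 + u * t) / (1 - u * t))) by (field; lra).
  unfold sinh. rewrite exp_Ropp, exp_ln by exact Hq. field. nra.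
- assert (kappa = 0) by lra. subst kappa. field.
Qed.

Lemma cs_atn : cs kappa (atn kappa t) = (1 - kappa * t ^ 2) / (1 + kappa * t ^ 2).
Proof.
unfold cs, atn. destruct (Rlt_dec 0 kappa) as [H1|H1]; [|destruct (Rlt_dec kappa 0) as [H2|H2]].
- assert (Hk := sqrt_lt_R0 _ H1).
  replace (sqrt kappa * (2 * atan (sqrt kappa * t) / sqrt kappa))
    with (2 * atan (sqrt kappa * t)) by (field; lra).
  rewrite cos_2a, sin_atan, cos_atan. set (u := sqrt kappa) in *.
  replace kappa with (u ^ 2) by (apply pow2_sqrt; lra).
  assert (Hp : 0 < 1 + (u * t)²) by (generalize (Rle_0_sqr (u * t)); lra).
  transitivity ((1 - (u * t)²) / (sqrt (1 + (u * t)²) * sqrt (1 + (u * t)²))).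
  + generalize (sqrt_lt_R0 _ Hp). set (v := sqrt _). intros Hv. unfold Rsqr. field. lra.
  + rewrite sqrt_sqrt by lra. unfold Rsqr. f_equal; [|f_equal]; ring.
- assert (Hk : 0 < sqrt (- kappa)) by (apply sqrt_lt_R0; lra).
  assert (Hs := sqrt_opp_one_sub H2).
  assert (HE : (sqrt (- kappa)) ^ 2 = - kappa) by (apply pow2_sqrt; lra).
  set (u := sqrt (- kappa)) in *.
  replace kappa with (- u ^ 2) by lra.
  assert (Hq : 0 < (1 + u * t) / (1 - u * t)) by (apply Rdiv_lt_0_compat; nra).
  replace (u * (ln ((1 + u * t) / (1 - u * t)) / u))
    with (ln ((1 + u * t) / (1 - u * t))) by (field; lra).
  unfold cosh. rewrite exp_Ropp, exp_ln by exact Hq. field. nra.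
- assert (kappa = 0) by lra. subst kappa. field.
Qed.

(** For [kappa <> 0] this is 2 kappa sn(r/2)^2 = 1 - cs r; the flat case is computed directly, since
    there that identity reads 0 = 0. *)
Lemma sn_half_atn : sn kappa (atn kappa t / 2) ^ 2 = t ^ 2 / (1 + kappa * t ^ 2).
Proof.
destruct (Req_dec kappa 0) as [H0 | H0].
{ unfold sn, atn. destruct (Rlt_dec 0 kappa) as [H1|H1]; [lra|].
  destruct (Rlt_dec kappa 0) as [H2|H2]; [lra|]. rewrite H0. field. }
transitivity ((1 - cs kappa (atn kappa t)) / (2 * kappa)).
2: { rewrite cs_atn. field. lra. }
generalize (atn kappa t). intros r.
unfold sn, cs. destruct (Rlt_dec 0 kappa) as [H1|H1]; [|destruct (Rlt_dec kappa 0) as [H2|H2]].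
- assert (Hk := sqrt_lt_R0 _ H1).
  replace (sqrt kappa * r) with (2 * (sqrt kappa * (r / 2))) by field.
  rewrite cos_2a_sin. set (u := sqrt kappa) in *.
  replace kappa with (u ^ 2) by (apply pow2_sqrt; lra). field. lra.
- assert (Hk : 0 < sqrt (- kappa)) by (apply sqrt_lt_R0; lra).
  assert (HE : (sqrt (- kappa)) ^ 2 = - kappa) by (apply pow2_sqrt; lra).
  set (u := sqrt (- kappa)) in *.
  replace kappa with (- u ^ 2) by lra.
  replace (u * r) with (u * (r / 2) + u * (r / 2)) by field.
  unfold sinh, cosh. rewrite !exp_Ropp, exp_plus.
  field. split; [apply Rgt_not_eq, exp_pos | lra].
- lra.
Qed.

Lemma atn_dom : I_dom kappa (atn kappa t).
Proof.
unfold I_dom, atn. destruct (Rlt_dec 0 kappa) as [H1|H1]; [|destruct (Rlt_dec kappa 0) as [H2|H2]].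
- assert (Hk := sqrt_lt_R0 _ H1).
  assert (H3 : 0 < atan (sqrt kappa * t)).
  { rewrite <- atan_0. apply atan_increasing. now apply Rmult_lt_0_compat. }
  assert (H4 := atan_bound (sqrt kappa * t)). split.
  + apply Rdiv_lt_0_compat; lra.
  + intros _. apply Rmult_lt_compat_r; [now apply Rinv_0_lt_compat | lra].
- split; [|lra]. assert (Hk : 0 < sqrt (- kappa)) by (apply sqrt_lt_R0; lra).
  assert (Hs := sqrt_opp_one_sub H2). apply Rdiv_lt_0_compat; [|exact Hk].
  rewrite <- ln_1. apply ln_increasing; [lra|].
  apply Rmult_lt_reg_r with (1 - sqrt (- kappa) * t); [exact Hs|].
  unfold Rdiv. rewrite Rmult_assoc, Rinv_l by lra. nra.
- lra.
Qed.

Lemma is_derive_atn : is_derive (atn kappa) t (2 / (1 + kappa * t ^ 2)).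
Proof.
unfold atn. destruct (Rlt_dec 0 kappa) as [H1|H1]; [|destruct (Rlt_dec kappa 0) as [H2|H2]].
- assert (Hk := sqrt_lt_R0 _ H1). set (u := sqrt kappa) in *.
  assert (HE : kappa = u ^ 2) by (symmetry; apply pow2_sqrt; lra). rewrite HE.
  assert (Hp : 0 < 1 + (u * t)²) by (generalize (Rle_0_sqr (u * t)); lra).
  evar_last.
  + apply (is_derive_ext (fun t => scal (2 / u) (atan (u * t)))).
    { intros x. unfold scal; simpl; unfold mult; simpl. field. lra. }
    apply is_derive_scal. apply (is_derive_comp atan).
    * apply is_derive_Reals, derivable_pt_lim_atan.
    * auto_derive; [exact I | reflexivity].
  + unfold scal; simpl; unfold mult; simpl. unfold Rsqr in *. field. nra.
- assert (Hk : 0 < sqrt (- kappa)) by (apply sqrt_lt_R0; lra).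
  assert (Hs := sqrt_opp_one_sub H2).
  assert (HE : (sqrt (- kappa)) ^ 2 = - kappa) by (apply pow2_sqrt; lra).
  set (u := sqrt (- kappa)) in *.
  replace kappa with (- u ^ 2) by lra.
  assert (Hq : 0 < (1 + u * t) / (1 - u * t)) by (apply Rdiv_lt_0_compat; nra).
  auto_derive.
  + repeat split; try exact Hq; lra.
  + field. repeat split; nra.
- assert (kappa = 0) by lra. subst kappa. auto_derive; [exact I | field].
Qed.

End Atn.

Lemma atn_surj (kappa r : R) :
  I_dom kappa r -> exists t, 0 < t /\ 0 < 1 + kappa * t ^ 2 /\ atn kappa t = r.
Proof.
unfold I_dom, atn. intros [Hr Hb].
destruct (Rlt_dec 0 kappa) as [H1|H1]; [|destruct (Rlt_dec kappa 0) as [H2|H2]].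
- assert (Hk := sqrt_lt_R0 _ H1). specialize (Hb H1).
  assert (Hb' : sqrt kappa * (r / 2) < PI / 2).
  { apply Rmult_lt_compat_l with (r := sqrt kappa) in Hb; [|exact Hk].
    replace (sqrt kappa * (PI / sqrt kappa)) with PI in Hb by (field; lra). lra. }
  assert (H0 : 0 < sqrt kappa * (r / 2)) by (apply Rmult_lt_0_compat; lra).
  exists (tan (sqrt kappa * (r / 2)) / sqrt kappa).
  assert (Ht : 0 < tan (sqrt kappa * (r / 2)) / sqrt kappa).
  { apply Rdiv_lt_0_compat; [|exact Hk]. now apply tan_gt_0. }
  split; [exact Ht|]. split.
  + generalize (pow2_ge_0 (tan (sqrt kappa * (r / 2)) / sqrt kappa)). nra.
  + replace (sqrt kappa * (tan (sqrt kappa * (r / 2)) / sqrt kappa))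
      with (tan (sqrt kappa * (r / 2))) by (field; lra).
    rewrite atan_tan by lra. field. lra.
- assert (Hk : 0 < sqrt (- kappa)) by (apply sqrt_lt_R0; lra).
  assert (HE : (sqrt (- kappa)) ^ 2 = - kappa) by (apply pow2_sqrt; lra).
  set (u := sqrt (- kappa)) in *.
  assert (He : 1 < exp (u * r)).
  { rewrite <- exp_0. apply exp_increasing. now apply Rmult_lt_0_compat. }
  set (e := exp (u * r)) in *.
  (* The witness is tanh(u r / 2) / u. *)
  exists ((e - 1) / (e + 1) / u). split; [|split].
  + apply Rdiv_lt_0_compat; [apply Rdiv_lt_0_compat|]; lra.
  + replace kappa with (- u ^ 2) by lra.
    replace (1 + - u ^ 2 * ((e - 1) / (e + 1) / u) ^ 2) with (4 * e / (e + 1) ^ 2) by (field; lra).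
    apply Rdiv_lt_0_compat; [lra|]. nra.
  + replace ((1 + u * ((e - 1) / (e + 1) / u)) / (1 - u * ((e - 1) / (e + 1) / u))) with e
      by (field; repeat split; lra).
    unfold e. rewrite ln_exp. field. lra.
- exists (r / 2). assert (kappa = 0) by lra. subst kappa. repeat split; lra.
Qed.

(** * The profile as a root of a quadratic equation *)

Section Profile.

Variables kappa H J : R.
Hypothesis HJ : Xi kappa (H, J).

(** In the half-angle coordinate t, with s = sin sigma, the first integral reads [lead] t^2 - 2 s t
    + J = 0; [sqrt_disc] is the square root of a quarter of the discriminant and [tsol] the larger
    root. *)
Definition lead : R := 4 * H + J * kappa.
Definition sqrt_disc (s : R) : R := sqrt (s ^ 2 - J * lead).
Definition tsol (s : R) : R := (s + sqrt_disc s) / lead.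

Lemma J_neg : J < 0.
Proof. destruct HJ as [H1 H2]. destruct (Rlt_dec 0 kappa); [apply H1 | apply H2]; lra. Qed.

Lemma lead_pos : 0 < lead.
Proof.
unfold lead. destruct HJ as [H1 H2]. destruct (Rlt_dec 0 kappa) as [Hk|Hk].
- destruct (H1 Hk) as [H3 [H4 _]].
  apply Rmult_lt_compat_r with (r := kappa) in H4; [|exact Hk].
  replace (- (4 * H / kappa) * kappa) with (- (4 * H)) in H4 by (field; lra). lra.
- destruct (H2 ltac:(lra)) as [H3 H4]. generalize (sqrt_pos (- kappa)). nra.
Qed.

Lemma sqrt_disc_arg_pos (s : R) : 0 < s ^ 2 - J * lead.
Proof. generalize J_neg lead_pos (pow2_ge_0 s). nra. Qed.

Lemma sqrt_disc_pos (s : R) : 0 < sqrt_disc s.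
Proof. apply sqrt_lt_R0, sqrt_disc_arg_pos. Qed.

Lemma sqrt_disc_sqr (s : R) : sqrt_disc s ^ 2 = s ^ 2 - J * lead.
Proof. apply pow2_sqrt. generalize (sqrt_disc_arg_pos s). lra. Qed.

Lemma sqrt_disc_opp (s : R) : sqrt_disc (- s) = sqrt_disc s.
Proof. unfold sqrt_disc. f_equal. ring. Qed.

Lemma lead_tsol (s : R) : lead * tsol s = s + sqrt_disc s.
Proof. unfold tsol. field. generalize lead_pos. lra. Qed.

(** Since J and [lead] have opposite signs, so do the two roots. *)
Lemma tsol_pos (s : R) : 0 < tsol s.
Proof.
apply Rdiv_lt_0_compat; [|apply lead_pos].
generalize (sqrt_disc_pos s) (sqrt_disc_sqr s) J_neg lead_pos. intros. nra.
Qed.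

Lemma tsol_root (s : R) : lead * tsol s ^ 2 - 2 * s * tsol s + J = 0.
Proof.
assert (Hl := lead_pos).
apply Rmult_eq_reg_l with lead; [|lra].
transitivity ((lead * tsol s) ^ 2 - 2 * s * (lead * tsol s) + J * lead); [ring|].
rewrite lead_tsol. generalize (sqrt_disc_sqr s). nra.
Qed.

(** For [kappa < 0] and u = sqrt(-kappa) the claim is u t < 1, that is u D < [lead] - s u with D =
    [sqrt_disc s]. The squares differ by [lead] (4 H - 2 s u), which is positive because H > u/2 and
    s <= 1. *)
Lemma tsol_lt (s : R) : s <= 1 -> 0 < 1 + kappa * tsol s ^ 2.
Proof.
intros Hs. assert (Ht := tsol_pos s). assert (Hl := lead_pos). assert (HJn := J_neg).
destruct (Rle_dec 0 kappa) as [Hk|Hk].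
{ generalize (pow2_ge_0 (tsol s)). nra. }
destruct HJ as [_ H2]. destruct (H2 ltac:(lra)) as [H3 _].
assert (Hk0 : 0 < sqrt (- kappa)) by (apply sqrt_lt_R0; lra).
assert (HE : (sqrt (- kappa)) ^ 2 = - kappa) by (apply pow2_sqrt; lra).
set (u := sqrt (- kappa)) in *.
assert (Hd : sqrt_disc s * u < lead - s * u).
{ assert (Hpos : 0 < lead - s * u) by (unfold lead; nra).
  assert (Hsq : (sqrt_disc s * u) ^ 2 < (lead - s * u) ^ 2).
  { rewrite Rpow_mult_distr, sqrt_disc_sqr.
    replace ((lead - s * u) ^ 2 - 0) with ((lead - s * u) ^ 2) by ring.
    assert (Hfac : 0 < lead * (4 * H - 2 * s * u)) by (apply Rmult_lt_0_compat; nra).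
    assert (Hlead : lead = 4 * H - J * u ^ 2) by (unfold lead; rewrite HE; ring).
    rewrite Hlead in Hfac |- *. nra. }
  generalize (sqrt_disc_pos s). nra. }
assert (Ht1 : tsol s * u < 1).
{ apply Rmult_lt_reg_l with lead; [exact Hl|].
  replace (lead * (tsol s * u)) with (lead * tsol s * u) by ring. rewrite lead_tsol. lra. }
replace kappa with (- u ^ 2) by lra.
assert (0 < tsol s * u) by nra. nra.
Qed.

Lemma first_integral_atn (t sigma : R) :
  0 < t -> 0 < 1 + kappa * t ^ 2 ->
  first_integral kappa H (atn kappa t) sigma =
  (2 * t * sin sigma - 4 * H * t ^ 2) / (1 + kappa * t ^ 2).
Proof.
intros Ht Hk. unfold first_integral. rewrite sn_atn by assumption.
destruct (Req_dec_T kappa 0) as [H0|H0].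
- unfold atn. destruct (Rlt_dec 0 kappa) as [H1|H1]; [lra|].
  destruct (Rlt_dec kappa 0) as [H2|H2]; [lra|]. rewrite H0. field.
- rewrite cs_atn by assumption. field. lra.
Qed.

(** The admissible radii correspond to the positive t with 1 + kappa t^2 > 0, and the quadratic has
    exactly one positive root. *)
Lemma radius_tsol (sigma : R) : radius kappa H J sigma = atn kappa (tsol (sin sigma)).
Proof.
assert (Hs : sin sigma <= 1) by apply SIN_bound.
set (s := sin sigma) in *.
assert (Ht := tsol_pos s). assert (Hk := tsol_lt s Hs). assert (Hroot := tsol_root s).
assert (Hl := lead_pos). assert (HJn := J_neg).
unfold radius. apply (iota_unique (V := R_CompleteNormedModule)).
- intros r [Hr Hfi]. destruct (atn_surj kappa r Hr) as [t [H1 [H2 <-]]]. f_equal.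
  rewrite first_integral_atn in Hfi by assumption. fold s in Hfi.
  assert (Hroot' : lead * t ^ 2 - 2 * s * t + J = 0).
  { apply Rmult_eq_compat_r with (r := 1 + kappa * t ^ 2) in Hfi.
    unfold Rdiv in Hfi. rewrite Rmult_assoc, Rinv_l, Rmult_1_r in Hfi by lra.
    unfold lead. lra. }
  assert (Hfac : (t - tsol s) * (lead * (t + tsol s) - 2 * s) = 0) by lra.
  (* By Vieta a root t other than [tsol s] would satisfy [lead] t [tsol s] = J < 0. *)
  apply Rmult_integral in Hfac. destruct Hfac as [Hfac | Hfac]; [lra|].
  exfalso. assert (lead * t * tsol s = J) by nra.
  assert (0 < lead * t * tsol s) by (apply Rmult_lt_0_compat; [apply Rmult_lt_0_compat|]; lra).
  lra.
- split; [now apply atn_dom|].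
  rewrite first_integral_atn by assumption. fold s.
  apply Rmult_eq_reg_r with (1 + kappa * tsol s ^ 2); [|lra].
  unfold Rdiv. rewrite Rmult_assoc, Rinv_l, Rmult_1_r by lra.
  unfold lead in Hroot. lra.
Qed.

(** At a fixed radius r the first integral is affine in sin sigma with slope sn r > 0. *)
Lemma radius_inj (x y : R) :
  radius kappa H J x = radius kappa H J y -> sin x = sin y.
Proof.
assert (Hfi : forall z, first_integral kappa H (radius kappa H J z) z = J /\
  0 < sn kappa (radius kappa H J z)).
{ intros z. assert (Hs : sin z <= 1) by apply SIN_bound.
  assert (Ht := tsol_pos (sin z)). assert (Hk := tsol_lt _ Hs).
  assert (Hroot := tsol_root (sin z)).
  rewrite radius_tsol, first_integral_atn, sn_atn by assumption. split.
  - apply Rmult_eq_reg_r with (1 + kappa * tsol (sin z) ^ 2); [|lra].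
    unfold Rdiv. rewrite Rmult_assoc, Rinv_l, Rmult_1_r by lra.
    unfold lead in Hroot. lra.
  - apply Rdiv_lt_0_compat; lra. }
intros He. destruct (Hfi x) as [Hx Hp]. destruct (Hfi y) as [Hy _].
rewrite <- He in Hy.
assert (Hxy : first_integral kappa H (radius kappa H J x) x =
  first_integral kappa H (radius kappa H J x) y) by lra.
unfold first_integral in Hxy.
apply Rplus_eq_reg_l, Rmult_eq_reg_l in Hxy; lra.
Qed.

(** Squared length of the Killing field d/dtheta + a d/dz generating the screw motions, in the
    half-angle coordinate. *)
Definition area_sqr (tau a t : R) : R :=
  (2 * t / (1 + kappa * t ^ 2)) ^ 2 + (4 * tau * (t ^ 2 / (1 + kappa * t ^ 2)) - a) ^ 2.

(** By the quadratic equation the denominator 2 H sn r - cs r sin sigma equals [lead] t - s, which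
    is [sqrt_disc s]. *)
Lemma dheight_tsol (tau a sigma : R) :
  dheight kappa tau a H J sigma =
  sqrt (area_sqr tau a (tsol (sin sigma))) / sqrt_disc (sin sigma) * sin sigma.
Proof.
assert (Hs : sin sigma <= 1) by apply SIN_bound.
unfold dheight. rewrite radius_tsol. set (s := sin sigma) in *.
assert (Ht := tsol_pos s). assert (Hk := tsol_lt s Hs). assert (Hroot := tsol_root s).
rewrite sn_half_atn, sn_atn, cs_atn by assumption.
do 2 f_equal.
assert (HD : sqrt_disc s = lead * tsol s - s) by (generalize (lead_tsol s); lra).
rewrite HD.
apply Rmult_eq_reg_r with (1 + kappa * tsol s ^ 2); [|lra].
field_simplify; [|lra].
assert (HJE : J = 2 * s * tsol s - lead * tsol s ^ 2) by lra.
assert (HH : 4 * H = lead - J * kappa) by (unfold lead; ring).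
rewrite HJE in HH. nra.
Qed.

Lemma area_sqr_pos (tau a t : R) : 0 < t -> 0 < 1 + kappa * t ^ 2 -> 0 < area_sqr tau a t.
Proof.
intros Ht Hk. unfold area_sqr.
assert (0 < 2 * t / (1 + kappa * t ^ 2)) by (apply Rdiv_lt_0_compat; lra).
generalize (pow2_ge_0 (4 * tau * (t ^ 2 / (1 + kappa * t ^ 2)) - a)). nra.
Qed.

Lemma is_derive_tsol (s : R) : is_derive tsol s (tsol s / sqrt_disc s).
Proof.
assert (Hl := lead_pos). assert (Hd := sqrt_disc_pos s). assert (Ha := sqrt_disc_arg_pos s).
unfold tsol, sqrt_disc in *. auto_derive.
- simpl in Ha. lra.
- replace (s * (s * 1)) with (s ^ 2) by ring. unfold Rminus in *.
  field. split; [|lra]. lra.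
Qed.

Definition dradius (sigma : R) : R :=
  2 / (1 + kappa * tsol (sin sigma) ^ 2) * (tsol (sin sigma) / sqrt_disc (sin sigma)) * cos sigma.

Lemma is_derive_tsol_sin (sigma : R) :
  is_derive (fun x => tsol (sin x)) sigma (tsol (sin sigma) / sqrt_disc (sin sigma) * cos sigma).
Proof.
evar_last.
- apply (is_derive_comp tsol sin); [apply is_derive_tsol|].
  apply is_derive_Reals, derivable_pt_lim_sin.
- apply Rmult_comm.
Qed.

Lemma is_derive_radius (sigma : R) : is_derive (radius kappa H J) sigma (dradius sigma).
Proof.
apply (is_derive_ext (fun x => atn kappa (tsol (sin x)))).
{ intros x. symmetry. apply radius_tsol. }
evar_last.
- apply (is_derive_comp (atn kappa)).
  + apply is_derive_atn; [apply tsol_pos | apply tsol_lt, SIN_bound].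
  + apply is_derive_tsol_sin.
- unfold dradius, scal; simpl; unfold mult; simpl. ring.
Qed.

Lemma ex_derive_tsol_sin (sigma : R) : ex_derive (fun x => tsol (sin x)) sigma.
Proof. eexists. apply is_derive_tsol_sin. Qed.

Lemma ex_derive_sqrt_disc_sin (sigma : R) : ex_derive (fun x => sqrt_disc (sin x)) sigma.
Proof.
unfold sqrt_disc. assert (Ha := sqrt_disc_arg_pos (sin sigma)). auto_derive. simpl in Ha. lra.
Qed.

Lemma continuous_dradius (sigma : R) : continuous dradius sigma.
Proof.
apply (ex_derive_continuous (V := R_NormedModule)). unfold dradius.
set (u := fun x => tsol (sin x)). set (v := fun x => sqrt_disc (sin x)).
assert (H1 : ex_derive u sigma) by apply ex_derive_tsol_sin.
assert (H2 : ex_derive v sigma) by apply ex_derive_sqrt_disc_sin.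
assert (H3 : 0 < v sigma) by apply sqrt_disc_pos.
assert (H4 : 0 < 1 + kappa * u sigma ^ 2) by apply tsol_lt, SIN_bound.
apply (ex_derive_ext (fun x => 2 / (1 + kappa * u x ^ 2) * (u x / v x) * cos x)).
{ reflexivity. }
clearbody u v.
auto_derive. repeat split; try assumption; simpl in H4; lra.
Qed.

Lemma continuous_dheight (tau a sigma : R) : continuous (dheight kappa tau a H J) sigma.
Proof.
apply (ex_derive_continuous (V := R_NormedModule)).
apply (ex_derive_ext (fun x => sqrt (area_sqr tau a (tsol (sin x))) / sqrt_disc (sin x) * sin x)).
{ intros x. symmetry. apply dheight_tsol. }
set (u := fun x => tsol (sin x)). set (v := fun x => sqrt_disc (sin x)).
assert (H1 : ex_derive u sigma) by apply ex_derive_tsol_sin.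
assert (H2 : ex_derive v sigma) by apply ex_derive_sqrt_disc_sin.
assert (H3 : 0 < v sigma) by apply sqrt_disc_pos.
assert (H4 : 0 < 1 + kappa * u sigma ^ 2) by apply tsol_lt, SIN_bound.
assert (H5 : 0 < area_sqr tau a (u sigma)) by (apply area_sqr_pos; [apply tsol_pos | exact H4]).
unfold area_sqr in H5.
apply (ex_derive_ext (fun x => sqrt ((2 * u x / (1 + kappa * u x ^ 2)) ^ 2 +
  (4 * tau * (u x ^ 2 / (1 + kappa * u x ^ 2)) - a) ^ 2) / v x * sin x)).
{ reflexivity. }
clearbody u v.
auto_derive. repeat split; try assumption; simpl in *; lra.
Qed.

End Profile.

(** * Height of the profile *)

Section Height.

Variable f : R -> R.
Hypothesis f_cont : forall x, continuous f x.
Hypothesis f_sym : forall x, f (PI - x) = f x.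
Hypothesis f_period : forall x, f (x + 2 * PI) = f x.
Hypothesis f_pos : forall x, 0 < x < PI -> 0 < f x.
Hypothesis f_neg : forall x, - PI < x < 0 -> f x < 0.
Hypothesis f_defect : RInt f (PI / 2) (3 * PI / 2) = 0.

Let h (x : R) : R := RInt f (PI / 2) x.

Lemma ex_RInt_f (x y : R) : ex_RInt f x y.
Proof. apply (ex_RInt_continuous (V := R_CompleteNormedModule)). intros z _. apply f_cont. Qed.

Lemma RInt_f_Chasles (x y z : R) : RInt f x z = RInt f x y + RInt f y z.
Proof. symmetry. apply (RInt_Chasles (V := R_CompleteNormedModule)); apply ex_RInt_f. Qed.

Lemma RInt_f_swap (x y : R) : RInt f x y = - RInt f y x.
Proof. generalize (RInt_f_Chasles x y x). rewrite RInt_point. unfold zero; simpl. lra. Qed.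

Lemma RInt_reflect (c x y : R) : (forall z, f (c - z) = f z) ->
  RInt f (c - x) (c - y) = - RInt f x y.
Proof.
intros Hc. generalize (RInt_comp_lin f (- 1) c x y (ex_RInt_f _ _)).
replace (- 1 * x + c) with (c - x) by ring. replace (- 1 * y + c) with (c - y) by ring.
intros <-. rewrite <- (RInt_opp (V := R_CompleteNormedModule)) by apply ex_RInt_f.
apply (RInt_ext (V := R_CompleteNormedModule)). intros z _.
rewrite <- (Hc z). unfold scal, opp; simpl; unfold mult; simpl.
replace (- 1 * z + c) with (c - z) by ring. ring.
Qed.

Lemma is_derive_height (x : R) : is_derive h x (f x).
Proof.
apply (is_derive_RInt (V := R_NormedModule) f h (PI / 2)); [|apply f_cont].
apply filter_forall. intros y. apply (RInt_correct (V := R_CompleteNormedModule)), ex_RInt_f.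
Qed.

Lemma height_sym (x : R) : h (PI - x) = - h x.
Proof.
unfold h. rewrite <- (RInt_reflect PI (PI / 2) x f_sym).
f_equal. field.
Qed.

(** A full period splits at 3 PI/2 into two halves exchanged by the reflection x |-> 3 PI - x; the
    integral over each is the closing defect up to sign. *)
Lemma height_period (x : R) : h (x + 2 * PI) = h x.
Proof.
unfold h. rewrite (RInt_f_Chasles _ (PI / 2 + 2 * PI)).
assert (H1 : RInt f (PI / 2 + 2 * PI) (x + 2 * PI) = RInt f (PI / 2) x).
{ generalize (RInt_comp_lin f 1 (2 * PI) (PI / 2) x (ex_RInt_f _ _)).
  rewrite !Rmult_1_l. intros <-. apply (RInt_ext (V := R_CompleteNormedModule)).
  intros z _. unfold scal; simpl; unfold mult; simpl. rewrite !Rmult_1_l. apply f_period. }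
assert (H2 : RInt f (PI / 2) (PI / 2 + 2 * PI) = 0).
{ rewrite (RInt_f_Chasles _ (3 * PI / 2)), f_defect.
  generalize (RInt_reflect (3 * PI) (3 * PI / 2) (PI / 2)).
  replace (3 * PI - 3 * PI / 2) with (3 * PI / 2) by field.
  replace (3 * PI - PI / 2) with (PI / 2 + 2 * PI) by field.
  intros ->; [rewrite RInt_f_swap, f_defect; lra|].
  intros z. replace (3 * PI - z) with (PI - z + 2 * PI) by ring. now rewrite f_period. }
rewrite H1, H2. ring.
Qed.

Lemma height_opp_PI2 : h (- (PI / 2)) = 0.
Proof.
rewrite <- height_period. unfold h.
replace (- (PI / 2) + 2 * PI) with (3 * PI / 2) by field. exact f_defect.
Qed.

Lemma RInt_f_opp_PI2 (x : R) : RInt f (- (PI / 2)) x = h x.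
Proof.
generalize (RInt_f_Chasles (PI / 2) (- (PI / 2)) x) height_opp_PI2. unfold h. lra.
Qed.

Lemma RInt_f_pos (x y : R) : 0 <= x < y -> y < PI -> 0 < RInt f x y.
Proof.
intros Hx Hy. apply RInt_gt_0; [lra| |intros; apply f_cont].
intros z Hz. apply f_pos. lra.
Qed.

Lemma RInt_f_neg (x y : R) : - PI < x < y -> y <= 0 -> RInt f x y < 0.
Proof.
intros Hx Hy.
assert (Ho : 0 < RInt (fun z => opp (f z)) x y).
{ apply RInt_gt_0; [lra| |].
  - intros z Hz. unfold opp; simpl. generalize (f_neg z). lra.
  - intros z _. apply (continuous_opp (V := R_NormedModule)), f_cont. }
rewrite (RInt_opp (V := R_CompleteNormedModule)) in Ho by apply ex_RInt_f.
unfold opp in Ho; simpl in Ho. lra.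
Qed.

(** For x >= 0 the height is minus an integral of positive values up to PI/2; for x < 0, the profile
    being closed, it is an integral of negative values from -PI/2. *)
Lemma height_neg (x : R) : - (PI / 2) < x < PI / 2 -> h x < 0.
Proof.
intros Hx. assert (HPI := PI_RGT_0). destruct (Rle_dec 0 x) as [H0 | H0].
- unfold h. rewrite RInt_f_swap. generalize (RInt_f_pos x (PI / 2)). lra.
- rewrite <- RInt_f_opp_PI2. apply RInt_f_neg; lra.
Qed.

(** The height decreases on [-PI/2, 0] and increases on [0, PI/2], so its minimum is at 0. *)
Lemma height_lower (x : R) : - (PI / 2) < x < PI / 2 -> - h x <= RInt f 0 (PI / 2).
Proof.
intros Hx. assert (HPI := PI_RGT_0). destruct (Req_dec x 0) as [-> | Hx0].
{ unfold h. rewrite (RInt_f_swap (PI / 2)). lra. }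
destruct (Rle_dec 0 x) as [H0 | H0].
- unfold h. rewrite RInt_f_swap. rewrite (RInt_f_Chasles 0 x).
  generalize (RInt_f_pos 0 x). lra.
- rewrite (RInt_f_swap 0). fold (h 0). rewrite <- !RInt_f_opp_PI2.
  rewrite (RInt_f_Chasles (- (PI / 2)) x 0). generalize (RInt_f_neg x 0). lra.
Qed.

(** Both sides are the depth of the profile at 0, measured from PI/2 and from -PI/2; this is the
    closing condition as an equality of two positive quantities. *)
Lemma RInt_f_fold : RInt f 0 (PI / 2) = RInt (fun x => - f (- x)) 0 (PI / 2).
Proof.
transitivity (RInt f 0 (- (PI / 2))).
- generalize (RInt_f_opp_PI2 0). unfold h. rewrite (RInt_f_swap (PI / 2)).
  rewrite (RInt_f_swap _ 0). lra.
- generalize (RInt_comp_lin f (- 1) 0 0 (PI / 2) (ex_RInt_f _ _)).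
  replace (- 1 * 0 + 0) with 0 by ring. replace (- 1 * (PI / 2) + 0) with (- (PI / 2)) by ring.
  intros <-. apply (RInt_ext (V := R_CompleteNormedModule)). intros z _.
  unfold scal; simpl; unfold mult; simpl. replace (- 1 * z + 0) with (- z) by ring.
  change (- 1 * f (- z) = - f (- z)). ring.
Qed.

End Height.

(** * Reduction of embeddedness to a bound on the depth of the profile *)

Section Tube.

Variables kappa tau a H J : R.
Hypothesis HJ : Xi kappa (H, J).
Hypothesis closed : closing_defect kappa tau a H J = 0.

Notation f := (dheight kappa tau a H J).

Lemma dheight_sym (x : R) : f (PI - x) = f x.
Proof. rewrite !dheight_tsol, sin_PI_x by exact HJ. reflexivity. Qed.

Lemma dheight_period (x : R) : f (x + 2 * PI) = f x.
Proof.
rewrite !dheight_tsol by exact HJ.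
replace (2 * PI) with (2 * PI * IZR 1) by ring. now rewrite sin_period_IZR.
Qed.

Lemma dheight_factor_pos (x : R) :
  0 < sqrt (area_sqr kappa tau a (tsol kappa H J (sin x))) / sqrt_disc kappa H J (sin x).
Proof.
apply Rdiv_lt_0_compat; [apply sqrt_lt_R0, area_sqr_pos | apply sqrt_disc_pos; exact HJ].
- now apply tsol_pos.
- apply tsol_lt; [exact HJ | apply SIN_bound].
Qed.

Lemma dheight_pos (x : R) : 0 < x < PI -> 0 < f x.
Proof.
intros Hx. rewrite dheight_tsol by exact HJ.
apply Rmult_lt_0_compat; [apply dheight_factor_pos | apply sin_gt_0; lra].
Qed.

Lemma dheight_neg (x : R) : - PI < x < 0 -> f x < 0.
Proof.
intros Hx. rewrite dheight_tsol by exact HJ.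
assert (Hs : sin x < 0) by (apply sin_lt_0_var; lra).
generalize (dheight_factor_pos x). nra.
Qed.

(** The radius is stationary only where cos vanishes, the height only where sin does. *)
Lemma regular_profile (x : R) : dradius kappa H J x = 0 -> f x <> 0.
Proof.
intros Hr Hf. rewrite dheight_tsol in Hf by exact HJ. unfold dradius in Hr.
assert (Ht := tsol_pos _ _ _ HJ (sin x)). assert (Hd := sqrt_disc_pos _ _ _ HJ (sin x)).
assert (Hk := tsol_lt _ _ _ HJ (sin x) (proj2 (SIN_bound x))).
assert (Hp := dheight_factor_pos x).
apply Rmult_integral in Hf. destruct Hf as [Hf | Hf]; [lra|].
apply Rmult_integral in Hr. destruct Hr as [Hr | Hr].
- assert (0 < 2 / (1 + kappa * tsol kappa H J (sin x) ^ 2) *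
    (tsol kappa H J (sin x) / sqrt_disc kappa H J (sin x))); [|lra].
  apply Rmult_lt_0_compat; apply Rdiv_lt_0_compat; lra.
- generalize (sin2_cos2 x). unfold Rsqr. rewrite Hr, Hf. lra.
Qed.

Lemma radius_sin (x y : R) : sin x = sin y -> radius kappa H J x = radius kappa H J y.
Proof. intros Hs. rewrite !radius_tsol by exact HJ. now rewrite Hs. Qed.

Lemma embedded_of_height :
  (a <> 0 -> RInt f 0 (PI / 2) < PI * Rabs a) -> embedded_tube kappa tau a (H, J).
Proof.
intros Hlow.
assert (Hc := continuous_dheight kappa H J HJ tau a).
apply (screw_map_embedding a (radius kappa H J) (height kappa tau a H J)
  (dradius kappa H J) f).
- intros x. now apply is_derive_radius.
- intros x. now apply is_derive_height.
- intros x. now apply continuous_dradius.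
- exact Hc.
- apply regular_profile.
- intros x. apply radius_sin. replace (2 * PI) with (2 * PI * IZR 1) by ring. apply sin_period_IZR.
- apply height_period; [exact Hc | apply dheight_sym | apply dheight_period | exact closed].
- intros x y. now apply radius_inj.
- apply height_sym; [exact Hc | apply dheight_sym].
- apply height_neg; [exact Hc | apply dheight_sym | apply dheight_period | apply dheight_pos
    | apply dheight_neg | exact closed].
- intros Ha x Hx. eapply Rle_lt_trans; [|now apply Hlow].
  apply height_lower; [exact Hc | apply dheight_sym | apply dheight_period | apply dheight_pos
    | apply dheight_neg | exact closed | exact Hx].
Qed.

End Tube.

(** With x = t^2 / (1 + kappa t^2), which is sn(r/2)^2, one has sn(r)^2 = 4 x (1 - kappa x), so the
    squared length is quadratic in x. *)
Lemma area_sqrE (kappa tau a t : R) :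
  1 + kappa * t ^ 2 <> 0 ->
  area_sqr kappa tau a t =
  a ^ 2 + t ^ 2 / (1 + kappa * t ^ 2) *
    ((16 * tau ^ 2 - 4 * kappa) * (t ^ 2 / (1 + kappa * t ^ 2)) - 2 * (4 * (a * tau) - 2)).
Proof. intros H. unfold area_sqr. field. exact H. Qed.

(* [p |-> p / (1 + kappa p)] is convex in [ln p] for [kappa <= 0]. *)
Lemma geometric_mean_lt (kappa m p q : R) :
  kappa <= 0 -> 0 < p -> 0 < q -> p * q = m ^ 2 -> 0 < m -> p <> q ->
  0 < 1 + kappa * p -> 0 < 1 + kappa * q -> 0 < 1 + kappa * m ->
  2 * (m / (1 + kappa * m)) < p / (1 + kappa * p) + q / (1 + kappa * q).
Proof.
intros Hk Hp Hq Hpq Hm Hne H1 H2 H3.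
apply Rminus_lt_0.
replace (p / (1 + kappa * p) + q / (1 + kappa * q) - 2 * (m / (1 + kappa * m)))
  with (((p + q + 2 * kappa * (p * q)) * (1 + kappa * m)
     - 2 * m * (1 + kappa * (p + q) + kappa ^ 2 * (p * q)))
     / ((1 + kappa * p) * (1 + kappa * q) * (1 + kappa * m))) by (field; lra).
apply Rdiv_lt_0_compat; [|repeat apply Rmult_lt_0_compat; assumption].
rewrite Hpq.
replace ((p + q + 2 * kappa * m ^ 2) * (1 + kappa * m) -
    2 * m * (1 + kappa * (p + q) + kappa ^ 2 * m ^ 2))
  with ((p + q - 2 * m) * (1 - kappa * m)) by ring.
apply Rmult_lt_0_compat; [|nra].
assert (H4 : 0 < (p - q) ^ 2) by (apply pow2_gt_0; lra).
assert ((2 * m) ^ 2 < (p + q) ^ 2) by nra. nra.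
Qed.

(** * The depth of the profile for nonpositive curvature *)

Section NonpositiveCurvature.

Variables kappa tau a H J : R.
Hypothesis HJ : Xi kappa (H, J).
Hypothesis kappa_le : kappa <= 0.
Hypothesis tau_pos : 0 < tau.
Hypothesis pitch : 1 / 2 < a * tau.
Hypothesis closed : closing_defect kappa tau a H J = 0.

Notation W := (area_sqr kappa tau a).
Notation t := (tsol kappa H J).

(** The negative root of the quadratic for s is -t(-s), so by Vieta the product is -J / [lead]. *)
Lemma tsol_opp (s : R) : t (- s) * t s = t 0 ^ 2.
Proof.
assert (Hl := lead_pos _ _ _ HJ).
assert (Hm : lead kappa H J * t 0 ^ 2 = - J) by (generalize (tsol_root _ _ _ HJ 0); lra).
apply Rmult_eq_reg_l with (lead kappa H J); [|lra]. rewrite Hm.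
apply Rmult_eq_reg_l with (lead kappa H J); [|lra].
transitivity ((lead kappa H J * t (- s)) * (lead kappa H J * t s)); [ring|].
rewrite !lead_tsol, sqrt_disc_opp by exact HJ.
generalize (sqrt_disc_sqr _ _ _ HJ s). lra.
Qed.

Lemma tsol_opp_lt (s : R) : 0 < s -> t (- s) < t s.
Proof.
intros Hs. apply Rmult_lt_reg_l with (lead kappa H J); [now apply lead_pos|].
rewrite !lead_tsol, sqrt_disc_opp by exact HJ. lra.
Qed.

Lemma dheight_opp (x : R) :
  - dheight kappa tau a H J (- x) =
  sqrt (W (t (- sin x))) / sqrt_disc kappa H J (sin x) * sin x.
Proof.
rewrite dheight_tsol, sin_neg, sqrt_disc_opp by exact HJ. ring.
Qed.

Lemma height_lt_nonpositive_curvature :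
  RInt (dheight kappa tau a H J) 0 (PI / 2) < PI * Rabs a.
Proof.
assert (HPI := PI_RGT_0).
assert (Hc := continuous_dheight kappa H J HJ tau a).
assert (Hc' : forall x, continuous (fun x => - dheight kappa tau a H J (- x)) x).
{ intros x. apply (continuous_opp (V := R_NormedModule) (fun x => dheight kappa tau a H J (- x))).
  apply (continuous_comp (fun x => - x) (dheight kappa tau a H J)); [|apply Hc].
  apply (continuous_opp (V := R_NormedModule) (fun x : R => x)), continuous_id. }
assert (Ha : 0 < a) by nra.
(* In x = X s the squared length is a^2 + x (c x - 2 b), with its minimum at x = b / c; the case
   distinction below compares X 0 with this point. *)
set (b := 4 * (a * tau) - 2). assert (Hb : 0 < b) by (unfold b; lra).
set (c := 16 * tau ^ 2 - 4 * kappa). assert (Hcp : 0 < c) by (unfold c; nra).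
assert (Hfold : RInt (dheight kappa tau a H J) 0 (PI / 2) =
  RInt (fun x => - dheight kappa tau a H J (- x)) 0 (PI / 2)).
{ apply RInt_f_fold; [exact Hc | now apply dheight_sym | now apply dheight_period | exact closed]. }
set (X := fun s => t s ^ 2 / (1 + kappa * t s ^ 2)).
assert (Hs : forall x, 0 < x < PI / 2 -> 0 < sin x < 1).
{ intros x Hx. split; [apply sin_gt_0; lra|].
  rewrite <- sin_PI2. apply sin_increasing_1; lra. }
assert (HW : forall s, s <= 1 -> W (t s) = a ^ 2 + X s * (c * X s - 2 * b)).
{ intros s Hs1. apply area_sqrE. generalize (tsol_lt _ _ _ HJ s Hs1). lra. }
assert (HX : forall s, s <= 1 -> 0 < X s).
{ intros s Hs1. apply Rdiv_lt_0_compat; [|now apply tsol_lt].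
  apply pow_lt. now apply tsol_pos. }
assert (Hmono : forall s s', s' <= 1 -> t s < t s' -> X s < X s').
{ intros s s' Hs1 Hlt. assert (Ht := tsol_pos _ _ _ HJ s).
  assert (H2 := tsol_lt _ _ _ HJ s' Hs1).
  assert (H1 : t s ^ 2 < t s' ^ 2) by nra.
  assert (H3 : 0 < 1 + kappa * t s ^ 2) by nra.
  unfold X. apply Rminus_lt_0.
  replace (t s' ^ 2 / (1 + kappa * t s' ^ 2) - t s ^ 2 / (1 + kappa * t s ^ 2))
    with ((t s' ^ 2 - t s ^ 2) / ((1 + kappa * t s' ^ 2) * (1 + kappa * t s ^ 2))) by (field; lra).
  apply Rdiv_lt_0_compat; [lra | now apply Rmult_lt_0_compat]. }
destruct (Rle_dec b (c * X 0)) as [Hx | Hx].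
(* Beyond the minimum the integrand strictly exceeds the folded one, against the closing condition
   [Hfold]. *)
- exfalso. apply (Rlt_irrefl (RInt (dheight kappa tau a H J) 0 (PI / 2))).
  rewrite Hfold at 1. apply RInt_lt; [lra | intros; apply Hc | intros; apply Hc' |].
  intros x Hx2. rewrite dheight_opp, dheight_tsol by exact HJ.
  destruct (Hs x Hx2) as [Hs0 Hs1]. set (s := sin x) in *.
  apply Rmult_lt_compat_r; [exact Hs0|].
  apply Rmult_lt_compat_r; [apply Rinv_0_lt_compat; now apply sqrt_disc_pos|].
  apply sqrt_lt_1_alt.
  assert (Hlt := tsol_opp_lt s Hs0).
  split; [apply Rlt_le, area_sqr_pos; [now apply tsol_pos | apply tsol_lt; [exact HJ | lra]]|].
  rewrite !HW by lra.
  assert (Hgm : 2 * X 0 < X (- s) + X s).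
  { assert (Ht := tsol_pos _ _ _ HJ (- s)). assert (Ht' := tsol_pos _ _ _ HJ s).
    apply geometric_mean_lt; try (apply tsol_lt; [exact HJ | lra]).
    - exact kappa_le.
    - now apply pow_lt.
    - now apply pow_lt.
    - rewrite <- Rpow_mult_distr, tsol_opp. reflexivity.
    - apply pow_lt. now apply tsol_pos.
    - nra. }
  assert (HXlt := Hmono (- s) s ltac:(lra) Hlt).
  (* This product is W(t(s)) - W(t(-s)); its second factor is positive because X(-s) + X(s) > 2 X(0)
     >= 2 b / c. *)
  assert (0 < (X s - X (- s)) * (c * (X (- s) + X s) - 2 * b)); [|lra].
  apply Rmult_lt_0_compat; [lra|]. nra.
(* Before the minimum, c X(-s) < b for s > 0, so W(t(-s)) <= a^2, and s is at most [sqrt_disc] of s.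
   The folded integrand is then at most [a] and the depth at most PI a / 2. *)
- assert (HR : RInt (fun x => - dheight kappa tau a H J (- x)) 0 (PI / 2)
    <= RInt (fun _ => a) 0 (PI / 2)).
  { apply RInt_le; [lra | | apply ex_RInt_const |].
    - apply (ex_RInt_continuous (V := R_CompleteNormedModule)). intros; apply Hc'.
    - intros x Hx2. rewrite dheight_opp.
      destruct (Hs x Hx2) as [Hs0 Hs1]. set (s := sin x) in *.
      assert (Hd := sqrt_disc_pos _ _ _ HJ s).
      assert (Hsd : s <= sqrt_disc kappa H J s).
      { generalize (sqrt_disc_sqr _ _ _ HJ s) (J_neg _ _ _ HJ) (lead_pos _ _ _ HJ). nra. }
      assert (HX0 : X (- s) < X 0).
      { apply Hmono; [lra|]. generalize (tsol_opp s) (tsol_opp_lt s Hs0)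
          (tsol_pos _ _ _ HJ (- s)) (tsol_pos _ _ _ HJ 0). nra. }
      assert (Hsq : sqrt (W (t (- s))) <= a).
      { apply Rle_trans with (sqrt (a ^ 2)); [|rewrite sqrt_pow2; lra].
        apply sqrt_le_1_alt. rewrite HW by lra. assert (Hp := HX (- s) ltac:(lra)).
        assert (c * X (- s) < 2 * b) by nra. nra. }
      replace (sqrt (W (t (- s))) / sqrt_disc kappa H J s * s)
        with (sqrt (W (t (- s))) * (s / sqrt_disc kappa H J s)) by (field; lra).
      assert (Hq : 0 <= s / sqrt_disc kappa H J s <= 1).
      { split; [apply Rlt_le, Rdiv_lt_0_compat; lra|].
        apply Rmult_le_reg_r with (sqrt_disc kappa H J s); [exact Hd|].
        unfold Rdiv. rewrite Rmult_assoc, Rinv_l, Rmult_1_r, Rmult_1_l by lra. exact Hsd. }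
      generalize (sqrt_pos (W (t (- s)))). nra. }
  rewrite RInt_const in HR. unfold scal in HR; simpl in HR; unfold mult in HR; simpl in HR.
  rewrite Hfold, Rabs_pos_eq by lra. nra.
Qed.

End NonpositiveCurvature.

(** * The depth of the profile for the explicit family in the product space *)

Section ProductCase.

Variables kappa a mu : R.
Hypothesis kappa_pos : 0 < kappa.
Hypothesis mu_pos : 0 < mu.

Notation J := (- (2 * mu / kappa)).
Hypothesis HJ : Xi kappa (mu, J).

Notation f := (dheight kappa 0 a mu J).

(** Here [lead] is 2 mu and D^2 = s^2 + 4 mu^2 / kappa. The bound follows from the explicit squared
    length a^2 + (2 mu / (kappa D))^2, the subadditivity of the square root, and s <= D. *)
Lemma dheight_product_le (x : R) : 0 <= sin x ->
  f x <= Rabs a + 2 * mu / kappa * (sin x / (sin x ^ 2 + 4 * mu ^ 2 / kappa)).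
Proof.
intros Hs. rewrite dheight_tsol by exact HJ. set (s := sin x) in *.
assert (Hs1 : s <= 1) by apply SIN_bound.
assert (Hd := sqrt_disc_pos _ _ _ HJ s). assert (Hd2 := sqrt_disc_sqr _ _ _ HJ s).
assert (Ht := tsol_pos _ _ _ HJ s). assert (Hk := tsol_lt _ _ _ HJ s Hs1).
assert (Hroot := tsol_root _ _ _ HJ s). assert (Hlt := lead_tsol _ _ _ HJ s).
assert (Hl : lead kappa mu J = 2 * mu) by (unfold lead; field; lra).
rewrite Hl in *.
replace (s ^ 2 - J * (2 * mu)) with (s ^ 2 + 4 * mu ^ 2 / kappa) in Hd2 by (field; lra).
rewrite <- Hd2. set (D := sqrt_disc kappa mu J s) in *. set (t := tsol kappa mu J s) in *.
assert (Hsd : s <= D).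
{ assert (0 < 4 * mu ^ 2 / kappa) by (apply Rdiv_lt_0_compat; nra). nra. }
(* The quadratic gives mu / kappa = mu t^2 - s t, hence mu / kappa + mu t^2 = t (2 mu t - s) = D
   t. *)
assert (HDt : 1 + kappa * t ^ 2 = kappa * D * t / mu).
{ apply Rmult_eq_reg_r with (mu / kappa); [|apply Rgt_not_eq, Rdiv_lt_0_compat; lra].
  transitivity (mu / kappa + mu * t ^ 2); [field; lra|].
  transitivity (D * t); [|field; lra].
  replace D with (2 * mu * t - s) by lra.
  replace (2 * mu / kappa) with (2 * (mu / kappa)) in Hroot by (field; lra). lra. }
assert (HW : area_sqr kappa 0 a t = (2 * mu / (kappa * D)) ^ 2 + a ^ 2).
{ unfold area_sqr. rewrite HDt. field. repeat split; lra. }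
assert (HE : 0 < 2 * mu / (kappa * D)) by (apply Rdiv_lt_0_compat; nra).
assert (Hsq : sqrt (area_sqr kappa 0 a t) <= Rabs a + 2 * mu / (kappa * D)).
{ assert (Hap := Rabs_pos a).
  rewrite <- (sqrt_pow2 (Rabs a + 2 * mu / (kappa * D))) by lra.
  apply sqrt_le_1_alt. rewrite HW, <- (pow2_abs a). nra. }
replace (sqrt (area_sqr kappa 0 a t) / D * s) with (sqrt (area_sqr kappa 0 a t) * (s / D))
  by (field; lra).
assert (Hq : 0 <= s / D <= 1).
{ split; [apply Rmult_le_pos; [exact Hs | apply Rlt_le, Rinv_0_lt_compat; lra]|].
  apply Rmult_le_reg_r with D; [exact Hd|].
  unfold Rdiv. rewrite Rmult_assoc, Rinv_l, Rmult_1_r, Rmult_1_l by lra. exact Hsd. }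
apply Rle_trans with ((Rabs a + 2 * mu / (kappa * D)) * (s / D)).
{ apply Rmult_le_compat_r; [lra | exact Hsq]. }
rewrite Rmult_plus_distr_r. apply Rplus_le_compat.
- generalize (Rabs_pos a). nra.
- right. field. lra.
Qed.

Lemma RInt_dheight_le (x y C : R) : 0 <= x <= y -> y <= PI / 2 ->
  (forall z, x < z < y -> f z <= C) -> RInt f x y <= (y - x) * C.
Proof.
intros Hx Hy HC.
replace ((y - x) * C) with (RInt (fun _ => C) x y)
  by exact (RInt_const (V := R_CompleteNormedModule) x y C).
apply RInt_le; [lra | | apply ex_RInt_const | exact HC].
apply (ex_RInt_continuous (V := R_CompleteNormedModule)). intros z _.
now apply continuous_dheight.
Qed.

(** Dropping sin^2 from the denominator and bounding the numerator by 1 leaves an excess over |a| of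
    at most 1 / (2 mu). *)
Lemma height_product_large : 1 / (2 * mu) < Rabs a -> RInt f 0 (PI / 2) < PI * Rabs a.
Proof.
intros Ha. assert (HPI := PI_RGT_0).
apply Rle_lt_trans with ((PI / 2 - 0) * (Rabs a + 1 / (2 * mu))); [|nra].
apply RInt_dheight_le; [lra | lra |]. intros z Hz.
assert (Hs : 0 < sin z) by (apply sin_gt_0; lra).
assert (Hs1 : sin z <= 1) by apply SIN_bound.
eapply Rle_trans; [apply dheight_product_le; lra|]. apply Rplus_le_compat_l.
assert (HE : 0 < 4 * mu ^ 2 / kappa) by (apply Rdiv_lt_0_compat; nra).
replace (1 / (2 * mu)) with (2 * mu / kappa * (1 / (4 * mu ^ 2 / kappa))) by (field; lra).
apply Rmult_le_compat_l; [apply Rlt_le, Rdiv_lt_0_compat; lra|].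
apply Rmult_le_compat; [lra | apply Rlt_le, Rinv_0_lt_compat; nra | lra |].
apply Rinv_le_contravar; nra.
Qed.

(* The excess over |a| is bounded on [0, eta], by AM-GM, and is O(mu) on
   [eta, PI/2]. *)
Lemma height_product_small (eta : R) : 0 < eta < PI / 2 ->
  eta / (2 * sqrt kappa) < PI * Rabs a / 4 ->
  PI * mu / (kappa * sin eta) < PI * Rabs a / 4 -> RInt f 0 (PI / 2) < PI * Rabs a.
Proof.
intros Heta H1 H2. assert (HPI := PI_RGT_0).
assert (Hsk := sqrt_lt_R0 _ kappa_pos).
assert (Hk2 : kappa = sqrt kappa ^ 2) by (symmetry; apply pow2_sqrt; lra).
assert (Hse : 0 < sin eta) by (apply sin_gt_0; lra).
assert (HE : 0 < 4 * mu ^ 2 / kappa) by (apply Rdiv_lt_0_compat; nra).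
rewrite (RInt_f_Chasles f (continuous_dheight _ _ _ HJ 0 a) 0 eta).
assert (HA : RInt f 0 eta <= (eta - 0) * (Rabs a + 1 / (2 * sqrt kappa))).
{ apply RInt_dheight_le; [lra | lra |]. intros z Hz.
  assert (Hs : 0 < sin z) by (apply sin_gt_0; lra).
  eapply Rle_trans; [apply dheight_product_le; lra|]. apply Rplus_le_compat_l.
  set (k := sqrt kappa) in *. rewrite Hk2 in HE |- *.
  apply Rmult_le_reg_r with (2 * k * (sin z ^ 2 + 4 * mu ^ 2 / k ^ 2)); [nra|].
  replace (2 * mu / k ^ 2 * (sin z / (sin z ^ 2 + 4 * mu ^ 2 / k ^ 2)) *
     (2 * k * (sin z ^ 2 + 4 * mu ^ 2 / k ^ 2))) with (2 * sin z * (2 * mu / k))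
    by (field; split; nra).
  replace (1 / (2 * k) * (2 * k * (sin z ^ 2 + 4 * mu ^ 2 / k ^ 2)))
    with (sin z ^ 2 + (2 * mu / k) ^ 2) by (field; lra).
  generalize (pow2_ge_0 (sin z - 2 * mu / k)). lra. }
assert (HB : RInt f eta (PI / 2) <= (PI / 2 - eta) * (Rabs a + 2 * mu / (kappa * sin eta))).
{ apply RInt_dheight_le; [lra | lra |]. intros z Hz.
  assert (Hs : sin eta < sin z) by (apply sin_increasing_1; lra).
  eapply Rle_trans; [apply dheight_product_le; lra|]. apply Rplus_le_compat_l.
  replace (2 * mu / (kappa * sin eta)) with (2 * mu / kappa * / sin eta) by (field; lra).
  apply Rmult_le_compat_l; [apply Rlt_le, Rdiv_lt_0_compat; lra|].
  apply Rmult_le_reg_r with (sin eta * (sin z ^ 2 + 4 * mu ^ 2 / kappa)); [nra|].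
  replace (sin z / (sin z ^ 2 + 4 * mu ^ 2 / kappa) * (sin eta * (sin z ^ 2 + 4 * mu ^ 2 / kappa)))
    with (sin z * sin eta) by (field; split; nra).
  replace (/ sin eta * (sin eta * (sin z ^ 2 + 4 * mu ^ 2 / kappa)))
    with (sin z ^ 2 + 4 * mu ^ 2 / kappa) by (field; split; nra).
  nra. }
assert (HC : 0 < 2 * mu / (kappa * sin eta)) by (apply Rdiv_lt_0_compat; nra).
replace (PI * mu / (kappa * sin eta)) with (PI / 2 * (2 * mu / (kappa * sin eta))) in H2
  by (field; lra).
replace (eta / (2 * sqrt kappa)) with (eta * (1 / (2 * sqrt kappa))) in H1 by (field; lra).
(* The term |a| contributes PI |a| / 2 in total, and each of the two excesses less than PI |a| /
   4. *)
assert (Hap := Rabs_pos a). nra.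
Qed.

End ProductCase.

(** * The two neighborhoods, by the sign of the curvature *)

Theorem theorem4p1 (kappa tau a : R) (c : R -> R * R)
  (hspace : is_S2xR kappa tau \/ is_Nil3 kappa tau \/ is_PSL2 kappa tau)
  (hadm : admissible kappa tau a)
  (hfam : tube_family kappa tau a c) :
  at_right 0 (fun mu => embedded_tube kappa tau a (c mu)) /\
  Rbar_locally p_infty (fun mu => embedded_tube kappa tau a (c mu)).
Proof.
destruct hfam as [_ [_ [hTheta [_ [_ [_ hprod]]]]]].
assert (Hred : is_S2xR kappa tau \/ (kappa <= 0 /\ 0 < tau)).
{ unfold is_Nil3, is_PSL2 in hspace. destruct hspace as [H | [H | H]]; [now left | |]; right; lra. }
destruct Hred as [[Hk Ht] | [Hk Ht]].
- subst tau.
  assert (Htube : forall mu, 0 < mu ->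
    (a <> 0 -> 0 < Rabs a -> Xi kappa (mu, - (2 * mu / kappa)) ->
      RInt (dheight kappa 0 a mu (- (2 * mu / kappa))) 0 (PI / 2) < PI * Rabs a) ->
    embedded_tube kappa 0 a (c mu)).
  { intros mu Hmu HR. destruct (hTheta mu Hmu) as [HX Hd].
    (* With tau = 0 the quantity 2 tau^2 - a tau kappa vanishes, so the family is the explicit
       one. *)
    rewrite hprod in HX, Hd |- * by lra. simpl in Hd.
    apply embedded_of_height; [exact HX | exact Hd |].
    intros Ha. apply HR; [exact Ha | now apply Rabs_pos_lt | exact HX]. }
  destruct (Req_dec a 0) as [Ha | Ha].
  { split; [exists (mkposreal 1 Rlt_0_1); intros mu _ Hmu | exists 0; intros mu Hmu];
      (apply Htube; [exact Hmu | tauto]). }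
  assert (Hap := Rabs_pos_lt _ Ha). assert (HPI := PI_RGT_0).
  assert (Hsk := sqrt_lt_R0 _ Hk). split.
  + assert (Hpa : 0 < sqrt kappa * PI * Rabs a).
    { apply Rmult_lt_0_compat; [now apply Rmult_lt_0_compat | exact Hap]. }
    (* The second bound yields eta / (2 sqrt kappa) <= PI |a| / 8. *)
    set (eta := Rmin (PI / 4) (sqrt kappa * PI * Rabs a / 4)).
    assert (Heta : 0 < eta < PI / 2).
    { split; [apply Rmin_pos; [lra|]|].
      - apply Rdiv_lt_0_compat; lra.
      - apply Rle_lt_trans with (PI / 4); [apply Rmin_l | lra]. }
    assert (Heta2 : eta <= sqrt kappa * PI * Rabs a / 4) by apply Rmin_r.
    assert (Hse : 0 < sin eta) by (apply sin_gt_0; lra).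
    (* This radius of the neighborhood of 0 is the value of mu at which PI mu / (kappa sin eta)
       equals PI |a| / 4. *)
    assert (Hm : 0 < kappa * sin eta * Rabs a / 4).
    { apply Rdiv_lt_0_compat; [|lra]. repeat apply Rmult_lt_0_compat; assumption. }
    exists (mkposreal _ Hm). intros mu Hball Hmu. simpl in Hball.
    assert (Hmu2 : mu < kappa * sin eta * Rabs a / 4).
    { unfold ball in Hball; simpl in Hball.
      unfold AbsRing_ball, abs, minus, plus, opp in Hball; simpl in Hball.
      apply Rabs_lt_between in Hball. lra. }
    apply Htube; [exact Hmu|]. intros _ _ HX.
    apply height_product_small with eta; try assumption.
    * apply Rmult_lt_reg_r with (2 * sqrt kappa); [lra|].
      replace (eta / (2 * sqrt kappa) * (2 * sqrt kappa)) with eta by (field; lra).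
      lra.
    * apply Rmult_lt_reg_r with (kappa * sin eta); [now apply Rmult_lt_0_compat|].
      replace (PI * mu / (kappa * sin eta) * (kappa * sin eta)) with (PI * mu) by (field; lra).
      apply Rmult_lt_compat_l with (r := PI) in Hmu2; lra.
  (* Above this threshold 1 / (2 mu) < |a|. *)
  + exists (1 / (2 * Rabs a)). intros mu Hmu.
    assert (Hp : 0 < 1 / (2 * Rabs a)) by (apply Rdiv_lt_0_compat; lra).
    apply Htube; [lra|]. intros _ _ HX.
    apply height_product_large; [exact Hk | lra | exact HX |].
    apply Rmult_lt_reg_r with (mu / Rabs a); [apply Rdiv_lt_0_compat; lra|].
    replace (1 / (2 * mu) * (mu / Rabs a)) with (1 / (2 * Rabs a)) by (field; lra).
    replace (Rabs a * (mu / Rabs a)) with mu by (field; lra). exact Hmu.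
(* Here kappa - 4 tau^2 < 0, so the sign in the admissibility condition is -1 and reverses the
   inequality. *)
- assert (Hpitch : 1 / 2 < a * tau).
  { destruct hadm as [H _]. specialize (H Hk). rewrite sign_eq_m1 in H by nra. lra. }
  assert (Htube : forall mu, 0 < mu -> embedded_tube kappa tau a (c mu)).
  { intros mu Hmu. destruct (hTheta mu Hmu) as [HX Hd].
    destruct (c mu) as [H J]. simpl in Hd.
    apply embedded_of_height; [exact HX | exact Hd |].
    intros _. now apply height_lt_nonpositive_curvature. }
  (* All tubes of the family being embedded, any neighborhoods serve. *)
  split.
  + exists (mkposreal 1 Rlt_0_1). intros mu _. apply Htube.
  + exists 0. apply Htube.
Qed.
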